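(* In the annotation model, there is a valid $(|A|,1)$ protocol for the LP streaming problem, where $|A|$ is the number of non-zero entries of the constraint matrix $A$.
   Context: LP streaming problem: a data stream contains the entries of vectors $\mathbf{b}\in\mathbb{R}^b$, $\mathbf{c}\in\mathbb{R}^c$ and the non-zero entries of a $b\times c$ matrix $A$, in arbitrary (possibly interleaved) order, each stream item indicating the object and index it pertains to (absent entries are zero; if an entry appears several times its value is the sum of the corresponding stream values). The task is to determine the value of the linear program $\min\{\mathbf{c}^T\mathbf{x} : A\mathbf{x}\le\mathbf{b}\}$. Annotation model: a data stream $\mathcal{A}$ of length $m$ is observed by a probabilistic verifier $\mathcal{V}$ (private random string, $w(m)$ machine words of working memory, each word $\Theta(\log m)$ bits) and a deterministic helper $\mathcal{H}$. After the stream ends, $\mathcal{H}$ sends an annotation that $\mathcal{V}$ reads as a stream. $\mathcal{V}$ outputs a value or $\perp$. A helper is valid for $\mathcal{A}$ if $\mathcal{V}$ outputs $f(\mathcal{A})$ with probability 1; it is $\tfrac13$-invalid for $\mathcal{A}$ if $\mathcal{V}$ outputs something other than $\perp$ with probability at most $1/3$. A protocol for $f$ is valid if some helper is valid for every $\mathcal{A}$, and for every helper and every stream, the helper is either valid or $\tfrac13$-invalid. Help cost: maximum annotation length of a shortest valid helper; verification cost: $w(m)$ (in words). An $(h,v)$ protocol is a valid protocol with help cost $O(h+1)$ and verification cost $O(v+1)$.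
   Formalization: The help bound O(|A|+1) is claimed only if each non-zero b_i (c_j) lies on a non-zero row (column) of A; otherwise, e.g. for A=0, feasibility encodes set disjointness and the claim fails. A real number counts as one word; b and c have length polynomial in m. *)

(* Defs.v *)
From HB Require Import structures.
From mathcomp Require Import all_boot all_order all_algebra.
From mathcomp Require Import classical_sets reals constructive_ereal ereal.

Set Implicit Arguments.
Unset Strict Implicit.
Unset Printing Implicit Defensive.

Import Order.TTheory GRing.Theory Num.Theory.
Local Open Scope ring_scope.

(* * The annotation model over the reals

   Stream entries are arbitrary reals, so working memory consists of words of
   two kinds: discrete words (indices, counters, control), each with N possible
   contents, and numeric registers.  Discrete words may be processed without
   restriction.  Numeric registers are only accessible through finitely many
   additions, multiplications and sign tests per symbol read; without that
   restriction a single real could encode the whole stream.  The bit size of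
   the registers is limited in [verification_cost_le] below. *)

Section Arithmetic.
Variable n : nat.

Inductive expr : Type :=
| EConst of int
| EInput            (* the number carried by the symbol being read *)
| EReg of 'I_n
| EAdd of expr & expr
| EMul of expr & expr.

Fixpoint eval (R : realType) (x : R) (r : 'I_n -> R) (e : expr) : R :=
  match e with
  | EConst z => z%:~R
  | EInput => x
  | EReg i => r i
  | EAdd e1 e2 => eval x r e1 + eval x r e2
  | EMul e1 e2 => eval x r e1 * eval x r e2
  end.

Inductive tree (L : Type) : Type :=
| Leaf of L
| IfNonneg of expr & tree L & tree L.

Fixpoint decide (L : Type) (R : realType) (x : R) (r : 'I_n -> R)
    (t : tree L) : L :=
  match t with
  | Leaf l => l
  | IfNonneg e t1 t2 =>
      if 0 <= eval x r e then decide x r t1 else decide x r t2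
  end.

End Arithmetic.

Arguments EInput {n}.
Arguments EConst {n}.

(* A verifier for streams of items (label, number), with labels in I.
   [vrand] is the set of its private random strings, drawn uniformly.  An
   annotation is a sequence of pairs (discrete word, number).
   [vanswer] returns None for the output "bottom". *)
Record verifier (I : finType) (N : nat) : Type := Verifier {
  vrand : finType;
  vrand_gt0 : (0 < #|vrand|)%N;
  vctl : finType;
  vreg : nat;
  vstart : vctl;
  vstep : vrand -> vctl -> I + 'I_N ->
          tree vreg (vctl * ('I_vreg -> expr vreg));
  vanswer : vrand -> vctl -> tree vreg (option (\bar (expr vreg)))
}.

Section AnnotationModel.
Variables (R : realType) (I : finType) (N m : nat).

Definition stream : Type := m.-tuple (I * R)%type.
Definition annotation : Type := seq ('I_N * R).
Definition helper : Type := stream -> annotation.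

Definition symbol : Type := ((I + 'I_N) * R)%type.

Definition transcript (s : stream) (h : annotation) : seq symbol :=
  [seq (inl x.1, x.2) | x <- s] ++ [seq (inr x.1, x.2) | x <- h].

Variable V : verifier I N.

Definition config : Type := (vctl V * ('I_(vreg V) -> R))%type.

Definition initial : config := (vstart V, fun=> 0).

Definition step (w : vrand V) (q : config) (y : symbol) : config :=
  let: (c, upd) := decide y.2 q.2 (vstep w q.1 y.1) in
  (c, fun i => eval y.2 q.2 (upd i)).

Definition run (w : vrand V) (ys : seq symbol) : config :=
  foldl (step w) initial ys.

Definition output (w : vrand V) (s : stream) (h : annotation) :
    option (\bar R) :=
  let q := run w (transcript s h) in
  omap (er_map (eval 0 q.2)) (decide 0 q.2 (vanswer w q.1)).

Definition prob (E : pred (vrand V)) : R := #|E|%:R / #|vrand V|%:R.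

Variable f : stream -> \bar R.

Definition valid_for (H : helper) (s : stream) : Prop :=
  prob [pred w | output w s (H s) == Some (f s)] = 1.

Definition third_invalid_for (H : helper) (s : stream) : Prop :=
  prob [pred w | output w s (H s) != None] <= 1 / 3.

Definition valid_protocol : Prop :=
  (exists H : helper, forall s, valid_for H s) /\
  (forall (H : helper) s, valid_for H s \/ third_invalid_for H s).

(* x is z / D with z an integer, `|z| <= B and D <= B *)
Definition representable (B D : nat) (x : R) : Prop :=
  (0 < D <= B)%N /\ exists2 z : int, (`|z| <= B)%N & x = z%:~R / D%:R.

(* Whenever the numbers read are fixed-precision numbers of log B bits, where
   log B is at least log (m + 2), every register holds at all times a fraction
   whose numerator and denominator have k log B bits. *)
Definition registers_fit (k : nat) : Prop :=
  forall (B D : nat) (s : stream) (h : annotation),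
    (m.+2 <= B)%N ->
    (forall y, y \in transcript s h -> representable B D y.2) ->
    forall (w : vrand V) (t : nat) (i : 'I_(vreg V)),
      exists D' : nat,
        representable (B ^ k) D' ((run w (take t (transcript s h))).2 i).

(* up_log N #|vctl V| is the number of words with N possible contents that are
   needed to store the discrete part of the memory. *)
Definition verification_cost_le (k W : nat) : Prop :=
  (up_log N #|vctl V| + vreg V <= W)%N /\ registers_fit k.

End AnnotationModel.

(* * The LP streaming problem *)

Section LP.
Variables (R : realType) (nb nc m : nat).

(* An item pertains to an entry of b, of c, or of A. *)
Definition lp_label : finType := ('I_nb + 'I_nc + 'I_nb * 'I_nc)%type.

Variable s : stream R lp_label m.

Definition entry (l : lp_label) : R := \sum_(x <- s | x.1 == l) x.2.

Definition lp_b : 'cV[R]_nb := \col_i entry (inl (inl i)).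
Definition lp_c : 'cV[R]_nc := \col_j entry (inl (inr j)).
Definition lp_A : 'M[R]_(nb, nc) := \matrix_(i, j) entry (inr (i, j)).

Definition lp_feasible : set 'cV[R]_nc :=
  [set x | forall i, (lp_A *m x) i 0 <= lp_b i 0]%classic.

(* +oo for an infeasible program, -oo for an unbounded one *)
Definition lp_value : \bar R :=
  ereal_inf [set ((lp_c^T *m x) 0 0)%:E | x in lp_feasible]%classic.

Definition lp_nnz : nat := #|[set p : 'I_nb * 'I_nc | lp_A p.1 p.2 != 0]|.

(* Every non-trivial constraint and every variable of the objective occurs
   in A.  Otherwise the size of b and c is not controlled by lp_nnz: with A = 0
   the program is feasible iff b >= 0, which encodes set disjointness. *)
Definition lp_covered : Prop :=
  (forall i, lp_b i 0 != 0 -> exists j, lp_A i j != 0) /\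
  (forall j, lp_c j 0 != 0 -> exists i, lp_A i j != 0).

End LP.

(* Main.v *)
Require Import Defs.
From HB Require Import structures.
From mathcomp Require Import all_boot all_order all_algebra.
From mathcomp Require Import classical_sets reals constructive_ereal ereal.
From mathcomp Require Import boolp ring lra zify.

Set Implicit Arguments.
Unset Strict Implicit.
Unset Printing Implicit Defensive.

Import Order.TTheory GRing.Theory Num.Theory.
Local Open Scope ring_scope.

(* The helper certifies the value: primal and dual solutions x, y without gap,
   or a Farkas vector y of an infeasible program, or a feasible point x and an
   improving ray d.  The verifier cannot remember x, so a copy x_ij of x_j is
   sent with every entry A_ij != 0, and likewise for d and y.  With weights
   A_ij^2 the variance of the copies vanishes iff they agree: the identities
   n_j = sum_i A_ij^2, n_j x_j = sum_i A_ij^2 x_ij and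
   n_j x_j^2 = sum_i A_ij^2 x_ij^2 force A_ij (x_ij - x_j) = 0.
   Thus a certificate is correct iff some polynomial identities hold, each of
   which adds up contributions of single packets and single stream items.  The
   verifier accumulates one combination of all their defects with independent
   random coefficients from {0, 1, 2}; if some defect is non-zero, this
   combination vanishes with probability at most 1/3.  As every row and column
   of a non-zero b_i or c_j meets the support of A, O(|A|) packets suffice. *)

(** * Linear programming duality *)

Lemma exists_between (R : realFieldType) (I : finType) (P Q : pred I)
    (l u : I -> R) :
  (forall i k, P i -> Q k -> l i <= u k) ->
  exists z, (forall i, P i -> l i <= z) /\ (forall k, Q k -> z <= u k).
Proof.
move=> lu; case: (pickP P) => [i0 Pi0|P0].
  case: (@Order.TotalTheory.arg_maxP _ _ _ i0 P l Pi0) => i Pi li.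
  by exists (l i); split=> // k Qk; apply: lu.
case: (pickP Q) => [k0 Qk0|Q0].
  case: (@Order.TotalTheory.arg_minP _ _ _ k0 Q u Qk0) => k Qk uk.
  by exists (u k); split=> // i; rewrite P0.
by exists 0; split=> i; rewrite ?P0 ?Q0.
Qed.

(** Fourier-Motzkin elimination, by induction on the number of variables: the nonnegative row
    combinations [W] eliminate the first variable and also carry a refutation of the reduced system
    back to the original one. *)
Lemma farkas_ord (R : realFieldType) (n : nat) (I : finType)
    (M : I -> 'I_n -> R) (q : I -> R) :
  (exists z : 'I_n -> R, forall i, \sum_j M i j * z j <= q i) \/
  (exists w : I -> R, [/\ forall i, 0 <= w i,
     forall j, \sum_i w i * M i j = 0 & \sum_i w i * q i < 0]).
Proof.
elim: n I M q => [|n IHn] I M q.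
  case: (pickP (fun i => q i < 0)) => [i qi|q_ge0].
    right; exists (fun k => (k == i)%:R); split=> [k|[]//|]; first exact: ler0n.
    rewrite (bigD1 i) //= eqxx mul1r big1 ?addr0 // => k /negPf ->.
    by rewrite mul0r.
  by left; exists (fun=> 0) => i; rewrite big_ord0 leNgt q_ge0.
(* The pair (i, k) combines a row with positive and a row with negative
   leading coefficient so as to cancel it; (i, i) keeps a row without it. *)
pose W (p : I * I) i : R :=
  if (0 < M p.1 ord0) && (M p.2 ord0 < 0) then
    (i == p.1)%:R * - M p.2 ord0 + (i == p.2)%:R * M p.1 ord0
  else if (p.1 == p.2) && (M p.1 ord0 == 0) then (i == p.1)%:R else 0.
have sumD (f : I -> R) k : \sum_i (i == k)%:R * f i = f k.
  rewrite (bigD1 k) //= eqxx mul1r big1 ?addr0 // => i /negPf ->.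
  by rewrite mul0r.
have sumW p (f : I -> R) : \sum_i W p i * f i =
  if (0 < M p.1 ord0) && (M p.2 ord0 < 0) then
    - M p.2 ord0 * f p.1 + M p.1 ord0 * f p.2
  else if (p.1 == p.2) && (M p.1 ord0 == 0) then f p.1 else 0.
  rewrite /W; case: ifP => _.
    rewrite -(sumD (fun i => - M p.2 ord0 * f i)).
    rewrite -(sumD (fun i => M p.1 ord0 * f i)) -big_split /=.
    by apply: eq_bigr => i _; rewrite mulrDl !mulrA.
  by case: ifP => _; [exact: sumD | apply: big1 => i _; rewrite mul0r].
have W_ge0 p i : 0 <= W p i.
  rewrite /W; case: ifP => [/andP[M1 M2]|_].
    by rewrite addr_ge0 // mulr_ge0 ?ler0n ?oppr_ge0 // ltW.
  by case: ifP.
have W0 p : \sum_i W p i * M i ord0 = 0.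
  rewrite sumW; case: ifP => _; first by ring.
  by case: ifP => // /andP[_ /eqP].
have exch (w : I * I -> R) (f : I -> R) :
    \sum_i (\sum_p w p * W p i) * f i = \sum_p w p * \sum_i W p i * f i.
  under eq_bigr do rewrite mulr_suml.
  rewrite exchange_big /=; apply: eq_bigr => p _.
  by rewrite mulr_sumr; apply: eq_bigr => i _; rewrite mulrA.
have [[z zP]|[w [w_ge0 wM wq]]] := IHn _
    (fun p j => \sum_i W p i * M i (lift ord0 j))
    (fun p => \sum_i W p i * q i).
  (* [r i] is what row [i] leaves for its leading term; [rP], on pairs of opposite signs, says that
     each lower bound on the leading variable lies below each upper one. *)
  left; pose r i := q i - \sum_j M i (lift ord0 j) * z j.
  have rP p : 0 <= \sum_i W p i * r i.
    rewrite /r (eq_bigr (fun i => W p i * q i -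
        \sum_j W p i * M i (lift ord0 j) * z j)); last first.
      move=> i _; rewrite mulrBr mulr_sumr; congr (_ - _).
      by apply: eq_bigr => j _; rewrite mulrA.
    rewrite sumrB exchange_big /= subr_ge0; apply: le_trans (zP p).
    by apply: ler_sum => j _; rewrite mulr_suml.
  have [|z0 [z0l z0u]] := @exists_between _ I (fun i => M i ord0 < 0)
      (fun i => 0 < M i ord0) (fun i => r i / M i ord0)
      (fun i => r i / M i ord0).
    move=> k i Mk Mi; have := rP (i, k); rewrite sumW /= Mi Mk /=.
    rewrite ler_ndivrMr // mulrAC ler_pdivrMr // mulNr addrC subr_ge0 => h.
    by rewrite mulrC (mulrC (r k)).
  exists (fun j => if unlift ord0 j is Some k then z k else z0) => i.
  rewrite big_ord_recl unlift_none; under eq_bigr do rewrite liftK.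
  rewrite -lerBrDr -/(r i).
  case: (ltrgt0P (M i ord0)) => [Mi|Mi|Mi].
  - by rewrite mulrC -ler_pdivlMr // z0u.
  - by rewrite mulrC -ler_ndivrMr // z0l.
  - have := rP (i, i); rewrite sumW /= Mi ltxx !eqxx /= => h.
    by rewrite mul0r.
right; exists (fun i => \sum_p w p * W p i); split.
- by move=> i; apply: sumr_ge0 => p _; apply: mulr_ge0.
- move=> j; rewrite exch; case: (unliftP ord0 j) => [k|] -> //.
  by apply: big1 => p _; rewrite W0 mulr0.
- by rewrite exch.
Qed.

Lemma farkas (R : realFieldType) (I J : finType) (M : I -> J -> R)
    (q : I -> R) :
  (exists z : J -> R, forall i, \sum_j M i j * z j <= q i) \/
  (exists w : I -> R, [/\ forall i, 0 <= w i,
     forall j, \sum_i w i * M i j = 0 & \sum_i w i * q i < 0]).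
Proof.
have [[z zP]|[w [w_ge0 wM wq]]] :=
    farkas_ord (fun i (j : 'I_#|J|) => M i (enum_val j)) q.
  left; exists (fun j => z (enum_rank j)) => i; apply: le_trans (zP i).
  rewrite (reindex (@enum_val J J)) /=; last first.
    by apply: onW_bij; apply: enum_val_bij.
  by rewrite (eq_bigr _ (fun j _ => congr1 _ (congr1 z (enum_valK j)))).
right; exists w; split=> // j.
by have := wM (enum_rank j); rewrite enum_rankK.
Qed.

(** Farkas' lemma is applied to the constraints and, if they are feasible, to the optimality system
    in x and y jointly. A refutation of the latter is a primal-dual pair scaled by the multiplier of
    the gap row. Weak duality makes this multiplier vanish, which leaves a Farkas vector or an
    improving ray. *)
Lemma lp_trichotomy (R : realFieldType) (I J : finType) (A : I -> J -> R)
    (b : I -> R) (c : J -> R) :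
  [\/ exists x y, [/\ forall i, \sum_j A i j * x j <= b i,
        forall i, 0 <= y i, forall j, \sum_i A i j * y i = - c j
        & \sum_i b i * y i + \sum_j c j * x j = 0],
      exists y, [/\ forall i, 0 <= y i, forall j, \sum_i A i j * y i = 0
        & \sum_i b i * y i < 0]
    | exists x d, [/\ forall i, \sum_j A i j * x j <= b i,
        forall i, \sum_j A i j * d j <= 0 & \sum_j c j * d j < 0]].
Proof.
have sumC (K : finType) (f g : K -> R) :
  \sum_k f k * g k = \sum_k g k * f k by apply: eq_bigr => k _; rewrite mulrC.
have swap (x : J -> R) (y : I -> R) :
    \sum_i (\sum_j A i j * x j) * y i = \sum_j x j * \sum_i A i j * y i.
  under eq_bigr do rewrite mulr_suml.
  rewrite exchange_big /=; apply: eq_bigr => j _; rewrite mulr_sumr.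
  by apply: eq_bigr => i _; ring.
have [[x xP]|[y [y_ge0 yA yb]]] := farkas A b; last first.
  apply: Or32; exists y; split=> // [j|]; first by rewrite sumC.
  by rewrite sumC.
(* The rows are A x <= b, the two halves of A^T y = - c, y >= 0 and b^T y + c^T x <= 0; weak duality
   supplies the opposite half of the last one. *)
pose M (k : I + (J + (J + (I + 'I_1)))) (l : J + I) : R :=
  match k, l with
  | inl i, inl j => A i j
  | inr (inl j), inr i => A i j
  | inr (inr (inl j)), inr i => - A i j
  | inr (inr (inr (inl i))), inr i' => - (i' == i)%:R
  | inr (inr (inr (inr _))), inl j => c j
  | inr (inr (inr (inr _))), inr i => b i
  | _, _ => 0
  end.
pose q (k : I + (J + (J + (I + 'I_1)))) : R :=
  match k with
  | inl i => b i
  | inr (inl j) => - c j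
  | inr (inr (inl j)) => c j
  | _ => 0
  end.
have weak x' y' : (forall i, \sum_j A i j * x' j <= b i) ->
    (forall i, 0 <= y' i) -> (forall j, \sum_i A i j * y' i = - c j) ->
    0 <= \sum_i b i * y' i + \sum_j c j * x' j.
  move=> x'P y'0 y'A.
  have -> : \sum_j c j * x' j = - \sum_i (\sum_j A i j * x' j) * y' i.
    rewrite swap -sumrN; apply: eq_bigr => j _; rewrite y'A; ring.
  rewrite subr_ge0; apply: ler_sum => i _; exact: ler_wpM2r.
have sum0 (K : finType) (f : K -> R) : \sum_k f k * 0 = 0.
  by apply: big1 => k _; rewrite mulr0.
have sum0l (K : finType) (f : K -> R) : \sum_k 0 * f k = 0.
  by apply: big1 => k _; rewrite mul0r.
have sumD (K : finType) (f : K -> R) k : \sum_i - (i == k)%:R * f i = - f k.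
  rewrite (bigD1 k) //= eqxx mulN1r big1 ?addr0 // => i /negPf ->.
  by rewrite oppr0 mul0r.
have [[z zP]|[w [w_ge0 wM wq]]] := farkas M q.
  have Hx i : \sum_j A i j * z (inl j) <= b i.
    by have := zP (inl i); rewrite big_sumType /= sum0l addr0.
  have Hy i : 0 <= z (inr i).
    have := zP (inr (inr (inr (inl i)))); rewrite big_sumType /= sum0l add0r.
    by rewrite (sumD _ (fun i => z (inr i))) oppr_le0.
  have HA j : \sum_i A i j * z (inr i) = - c j.
    apply/le_anti/andP; split.
      by have := zP (inr (inl j)); rewrite big_sumType /= sum0l add0r.
    have := zP (inr (inr (inl j))); rewrite big_sumType /= sum0l add0r.
    by under eq_bigr do rewrite mulNr; rewrite sumrN lerNl.
  apply: Or31; exists (z \o inl), (z \o inr); split=> //=.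
  apply/le_anti/andP; split; last exact: weak.
  by have := zP (inr (inr (inr (inr ord0)))); rewrite big_sumType /= addrC.
(* By [wx] and [wy], the multipliers [w \o inl] and the vector [d] satisfy the dual and the primal
   constraints for data scaled by [lam]. *)
pose lam := w (inr (inr (inr (inr ord0)))).
pose d j := w (inr (inr (inl j))) - w (inr (inl j)).
have wx j : \sum_i A i j * w (inl i) = - (lam * c j).
  have := wM (inl j); rewrite !big_sumType /= !sum0 big_ord1 -/lam sumC.
  by move=> h; lra.
have wy i : \sum_j A i j * d j = lam * b i - w (inr (inr (inr (inl i)))).
  have := wM (inr i); rewrite !big_sumType /= !sum0 big_ord1 -/lam.
  rewrite (eq_bigr (fun j => A i j * w (inr (inl j)))); last first.
    by move=> j _; rewrite mulrC.
  rewrite [X in 0 + (_ + (X + _))](eq_bigr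
      (fun j => - (A i j * w (inr (inr (inl j)))))); last first.
    by move=> j _; ring.
  rewrite [X in 0 + (_ + (_ + (X + _)))](eq_bigr
      (fun k => - (k == i)%:R * w (inr (inr (inr (inl k)))))); last first.
    by move=> k _; rewrite eq_sym mulrC.
  rewrite (sumD _ (fun k => w (inr (inr (inr (inl k)))))) sumrN.
  under [in X in _ -> X]eq_bigr do rewrite /d mulrBr.
  by rewrite sumrB => h; lra.
have wqE : \sum_i b i * w (inl i) + \sum_j c j * d j < 0.
  move: wq; rewrite !big_sumType /= big_ord1 mulr0 addr0 sum0 addr0.
  rewrite (sumC I) -big_split /=; congr (_ + _ < 0).
  by apply: eq_bigr => j _; rewrite /d; ring.
have lam_ge0 : 0 <= lam by apply: w_ge0.
have [lam_gt0|lam_le0] := ltP 0 lam.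
  have lam_neq0 : lam != 0 by rewrite gt_eqF.
  have scale (K : finType) (f g : K -> R) :
      \sum_k f k * (lam^-1 * g k) = lam^-1 * \sum_k f k * g k.
    by rewrite mulr_sumr; apply: eq_bigr => k _; ring.
  have := weak (fun j => lam^-1 * d j) (fun i => lam^-1 * w (inl i)).
  rewrite !scale -mulrDr pmulr_rge0 ?invr_gt0 // leNgt wqE => h.
  suff: false by []; apply: h.
  - move=> i; rewrite scale wy mulrBr mulKf // gerBl.
    by rewrite mulr_ge0 ?invr_ge0.
  - by move=> i; rewrite mulr_ge0 ?invr_ge0.
  - by move=> j; rewrite scale wx mulrN mulKf.
have lam0 : lam = 0 by apply/le_anti/andP.
(* For [lam = 0] both vectors solve homogeneous systems and the sum of their values is negative, so
   one of the two values is. *)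
have [by_lt0|by_ge0] := ltP (\sum_i b i * w (inl i)) 0.
  apply: Or32; exists (w \o inl); split=> //= j.
  by rewrite wx lam0 mul0r oppr0.
apply: Or33; exists x, d; split=> // [i|].
- by rewrite wy lam0 mul0r sub0r oppr_le0.
- by lra.
Qed.

(** * Certificates as systems of identities *)

(* The kind of value that is claimed: None for a finite one, Some true for an
   infeasible program and Some false for an unbounded one. *)
Definition mode : finType := option bool.

Section Fingerprint.
Variables nb nc : nat.
Local Notation label := (lp_label nb nc).

(* One key for every identity:
   - data_key l: the claimed entry l is the one in the stream;
   - row_key i 0 and 1: A x + t = b (A x + t = 0 if no x is needed) and
     A d + u = 0, with slacks t, u >= 0;
   - row_key i 2, 3 and 4: agreement of the copies of y_i;
   - col_key j 0: A^T y = - c (A^T y = 0 if the program is infeasible);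
   - col_key j 1, 2 and 3: agreement of the copies of x_j; with 4 and 5 in place
     of 2 and 3, of those of d_j;
   - gap_key: b^T y + c^T x = 0. *)
Definition key : finType :=
  (label + 'I_nb * 'I_5 + 'I_nc * 'I_6 + 'I_1)%type.
Definition data_key (l : label) : key := inl (inl (inl l)).
Definition row_key (i : 'I_nb) (k : 'I_5) : key := inl (inl (inr (i, k))).
Definition col_key (j : 'I_nc) (k : 'I_6) : key := inl (inr (j, k)).
Definition gap_key : key := inr ord0.

(** Zero right-hand sides let the zero vector stand in for x in the infeasible mode and for y in the
    unbounded one; in the infeasible mode A^T y = 0 is also the condition on a Farkas vector. *)
Definition primal_rhs (mu : mode) : int := (mu != Some true)%:R.
Definition dual_rhs (mu : mode) : int := (mu == None)%:R.

(* The packets are (b_i, y_i, t_i, u_i, sum_j A_ij^2) for a row,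
   (c_j, x_j, d_j, sum_i A_ij^2, _) for a column and (A_ij, x_j, d_j, y_i, _) for
   an entry.  A term (q, (z, ks)) contributes z times the product of the
   components in ks to the identity q; no term is constant, so an absent packet
   amounts to a zero packet. *)
Definition terms (mu : mode) (l : label) : seq (key * (int * seq 'I_5)) :=
  match l with
  | inl (inl i) =>
    [:: (data_key l, (1, [:: 0]));
        (row_key i 0, (1, [:: 2])); (row_key i 0, (- primal_rhs mu, [:: 0]));
        (row_key i 1, (1, [:: 3]));
        (row_key i 2, (1, [:: 4]));
        (row_key i 3, (1, [:: 4; 1]));
        (row_key i 4, (1, [:: 4; 1; 1]));
        (gap_key, (dual_rhs mu, [:: 0; 1]))]
  | inl (inr j) =>
    [:: (data_key l, (1, [:: 0]));
        (col_key j 0, (dual_rhs mu, [:: 0]));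
        (col_key j 1, (1, [:: 3]));
        (col_key j 2, (1, [:: 3; 1]));
        (col_key j 3, (1, [:: 3; 1; 1]));
        (col_key j 4, (1, [:: 3; 2]));
        (col_key j 5, (1, [:: 3; 2; 2]));
        (gap_key, (dual_rhs mu, [:: 0; 1]))]
  | inr (i, j) =>
    [:: (data_key l, (1, [:: 0]));
        (row_key i 0, (1, [:: 0; 1]));
        (row_key i 1, (1, [:: 0; 2]));
        (row_key i 2, (-1, [:: 0; 0]));
        (row_key i 3, (-1, [:: 0; 0; 3]));
        (row_key i 4, (-1, [:: 0; 0; 3; 3]));
        (col_key j 0, (1, [:: 0; 3]));
        (col_key j 1, (-1, [:: 0; 0]));
        (col_key j 2, (-1, [:: 0; 0; 1]));
        (col_key j 3, (-1, [:: 0; 0; 1; 1]));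
        (col_key j 4, (-1, [:: 0; 0; 2]));
        (col_key j 5, (-1, [:: 0; 0; 2; 2]))]
  end.

(* c^T x, b^T y or c^T d, according to the mode *)
Definition value_terms (mu : mode) (l : label) : seq (seq 'I_5) :=
  match mu, l with
  | None, inl (inr _) => [:: [:: 0; 1]]
  | Some true, inl (inl _) => [:: [:: 0; 1]]
  | Some false, inl (inr _) => [:: [:: 0; 2]]
  | _, _ => [::]
  end.

(** The dual variable y_i and the slacks t_i and u_i of a row packet. *)
Definition signed (l : label) : seq 'I_5 :=
  if l is inl (inl _) then [:: 1; 2; 3] else [::].

Variable R : realType.
Implicit Types (g : key -> R) (u : 'I_5 -> R) (U : label -> 'I_5 -> R).

Definition mono u (ks : seq 'I_5) : R := \prod_(k <- ks) u k.

Definition fp g mu l u : R :=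
  \sum_(t <- terms mu l) g t.1 * (mono u t.2.2 * t.2.1%:~R).

Definition objective mu l u : R := \sum_(ks <- value_terms mu l) mono u ks.

Definition row_viol mu U (i : 'I_nb) (k : 'I_5) : R :=
  let r := U (inl (inl i)) in let E j := U (inr (i, j)) in
  [:: r 2 - (primal_rhs mu)%:~R * r 0 + \sum_j E j 0 * E j 1;
      r 3 + \sum_j E j 0 * E j 2;
      r 4 - \sum_j E j 0 ^+ 2;
      r 4 * r 1 - \sum_j E j 0 ^+ 2 * E j 3;
      r 4 * r 1 ^+ 2 - \sum_j E j 0 ^+ 2 * E j 3 ^+ 2]`_k.

Definition col_viol mu U (j : 'I_nc) (k : 'I_6) : R :=
  let r := U (inl (inr j)) in let E i := U (inr (i, j)) in
  [:: (dual_rhs mu)%:~R * r 0 + \sum_i E i 0 * E i 3;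
      r 3 - \sum_i E i 0 ^+ 2;
      r 3 * r 1 - \sum_i E i 0 ^+ 2 * E i 1;
      r 3 * r 1 ^+ 2 - \sum_i E i 0 ^+ 2 * E i 1 ^+ 2;
      r 3 * r 2 - \sum_i E i 0 ^+ 2 * E i 2;
      r 3 * r 2 ^+ 2 - \sum_i E i 0 ^+ 2 * E i 2 ^+ 2]`_k.

Definition gap_viol mu U : R :=
  (dual_rhs mu)%:~R * (\sum_i U (inl (inl i)) 0 * U (inl (inl i)) 1 +
                       \sum_j U (inl (inr j)) 0 * U (inl (inr j)) 1).

Definition viol mu U (e : label -> R) (q : key) : R :=
  match q with
  | inl (inl (inl l)) => U l 0 - e l
  | inl (inl (inr (i, k))) => row_viol mu U i k
  | inl (inr (j, k)) => col_viol mu U j k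
  | inr _ => gap_viol mu U
  end.

Lemma big_I5 (f : 'I_5 -> R) : \sum_k f k = f 0 + f 1 + f 2 + f 3 + f 4.
Proof.
rewrite !big_ord_recl big_ord0 addr0 !addrA.
by do ![congr (_ + _)|congr f; apply: val_inj].
Qed.

Lemma big_I6 (f : 'I_6 -> R) :
  \sum_k f k = f 0 + f 1 + f 2 + f 3 + f 4 + f 5.
Proof.
rewrite !big_ord_recl big_ord0 addr0 !addrA.
by do ![congr (_ + _)|congr f; apply: val_inj].
Qed.

(** Double counting: the left side can be accumulated packet by packet and item by item, the right
    side is the combination of all defects. *)
Lemma sum_fp g mu U (e : label -> R) :
  \sum_l fp g mu l (U l) - \sum_l g (data_key l) * e l =
  \sum_q g q * viol mu U e q.
Proof.
rewrite -sumrB.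
(* [D] and [G] collect the data and gap terms, [rowh] and [colh] the other terms of row and column
   packets, [rowp] and [colp] those of an entry packet in its row and its column. *)
pose rowp i j := let E := U (inr (i, j)) in
  g (row_key i 0) * (E 0 * E 1) + g (row_key i 1) * (E 0 * E 2)
  - g (row_key i 2) * E 0 ^+ 2 - g (row_key i 3) * (E 0 ^+ 2 * E 3)
  - g (row_key i 4) * (E 0 ^+ 2 * E 3 ^+ 2).
pose colp i j := let E := U (inr (i, j)) in
  g (col_key j 0) * (E 0 * E 3)
  - g (col_key j 1) * E 0 ^+ 2 - g (col_key j 2) * (E 0 ^+ 2 * E 1)
  - g (col_key j 3) * (E 0 ^+ 2 * E 1 ^+ 2)
  - g (col_key j 4) * (E 0 ^+ 2 * E 2)
  - g (col_key j 5) * (E 0 ^+ 2 * E 2 ^+ 2).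
pose D l := g (data_key l) * (U l 0 - e l).
pose G l := g gap_key * ((dual_rhs mu)%:~R * (U l 0 * U l 1)).
pose rowh i := let r := U (inl (inl i)) in
  g (row_key i 0) * (r 2 - (primal_rhs mu)%:~R * r 0) + g (row_key i 1) * r 3
  + g (row_key i 2) * r 4 + g (row_key i 3) * (r 4 * r 1)
  + g (row_key i 4) * (r 4 * r 1 ^+ 2).
pose colh j := let r := U (inl (inr j)) in
  g (col_key j 0) * ((dual_rhs mu)%:~R * r 0)
  + g (col_key j 1) * r 3 + g (col_key j 2) * (r 3 * r 1)
  + g (col_key j 3) * (r 3 * r 1 ^+ 2)
  + g (col_key j 4) * (r 3 * r 2) + g (col_key j 5) * (r 3 * r 2 ^+ 2).
have rowE i : \sum_k g (row_key i k) * row_viol mu U i k =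
    rowh i + \sum_j rowp i j.
  rewrite big_I5 /row_viol /= /rowh /rowp /= !(big_split, sumrN) /= -!mulr_sumr.
  ring.
have colE j : \sum_k g (col_key j k) * col_viol mu U j k =
    colh j + \sum_i colp i j.
  rewrite big_I6 /col_viol /= /colh /colp /= !(big_split, sumrN) /= -!mulr_sumr.
  ring.
transitivity (\sum_i (D (inl (inl i)) + G (inl (inl i)) + rowh i)
   + \sum_j (D (inl (inr j)) + G (inl (inr j)) + colh j)
   + \sum_i \sum_j (D (inr (i, j)) + rowp i j + colp i j)).
  rewrite !big_sumType /= pair_big /=.
  congr (_ + _ + _); apply: eq_bigr;
    [move=> i _|move=> j _|move=> [i j] _];
    by rewrite /fp /= !big_cons big_nil /mono /= !big_cons !big_nil
      /D ?/G ?/rowh ?/colh ?/rowp ?/colp /=; ring.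
have keyE (I J : finType) (f : I * J -> R) (h : I -> J -> R) :
    (forall i j, f (i, j) = h i j) -> \sum_p f p = \sum_i \sum_j h i j.
  by move=> fh; rewrite pair_bigA /=; apply: eq_bigr => -[i j].
have gapE : g gap_key * gap_viol mu U =
    \sum_i G (inl (inl i)) + \sum_j G (inl (inr j)).
  by rewrite /gap_viol !mulrDr !mulr_sumr.
rewrite big_sumType /= big_ord1 gapE !big_sumType /=.
rewrite (keyE _ _ _ (fun i k => g (row_key i k) * row_viol mu U i k)) //.
rewrite (keyE _ _ _ (fun j k => g (col_key j k) * col_viol mu U j k)) //.
rewrite (eq_bigr _ (fun i _ => rowE i)) (eq_bigr _ (fun j _ => colE j)).
rewrite (keyE _ _ _ (fun i j => D (inr (i, j)))) //.
rewrite -[\sum_i _ * (U (inl (inl i)) 0 - _)]/(\sum_i D (inl (inl i))).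
rewrite -[\sum_j _ * (U (inl (inr j)) 0 - _)]/(\sum_j D (inl (inr j))).
clear rowE colE gapE; clearbody rowp colp rowh colh D G.
under [\sum_i \sum_j (_ + _ + _)]eq_bigr do rewrite !big_split.
rewrite !big_split /= [\sum_j \sum_i colp i j]exchange_big /=.
ring.
Qed.

End Fingerprint.

Arguments row_key {nb nc}.
Arguments col_key {nb nc}.
Arguments data_key {nb nc}.
Arguments gap_key {nb nc}.

(** The three identities make the sum of the squares of [a i * (z i - x)] vanish. Where [a i] is
    zero the copy [z i] stays free. *)
Lemma weighted_mean (R : realFieldType) (I : finType) (a z : I -> R) (n x : R) :
  n = \sum_i a i ^+ 2 -> n * x = \sum_i a i ^+ 2 * z i ->
  n * x ^+ 2 = \sum_i a i ^+ 2 * z i ^+ 2 -> forall i, a i * z i = a i * x.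
Proof.
move=> nE nx nxx i.
have /psumr_eq0P : \sum_i (a i * (z i - x)) ^+ 2 = 0.
  rewrite (eq_bigr (fun i => a i ^+ 2 * z i ^+ 2 - 2 * x * (a i ^+ 2 * z i)
      + x ^+ 2 * a i ^+ 2)) => [|k _]; last by ring.
  by rewrite !big_split /= sumrN -!mulr_sumr -nE -nx -nxx; ring.
move=> /(_ (fun i _ => sqr_ge0 _)) /(_ i isT) /eqP.
by rewrite sqrf_eq0 mulrBr subr_eq0 => /eqP.
Qed.

(** * Soundness of certificates *)

Section Value.
Variables (R : realType) (nb nc m : nat) (s : stream R (lp_label nb nc) m).

Local Notation A i j := (entry s (inr (i, j))).
Local Notation b i := (entry s (inl (inl i))).
Local Notation c j := (entry s (inl (inr j))).

Lemma lp_feasibleP (x : 'cV[R]_nc) :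
  lp_feasible s x <-> forall i, \sum_j A i j * x j 0 <= b i.
Proof.
split=> xP i; have := xP i; rewrite !mxE.
  by under eq_bigr do rewrite mxE.
by under [X in _ -> X <= _]eq_bigr do rewrite mxE.
Qed.

Lemma lp_costE (x : 'cV[R]_nc) : ((lp_c s)^T *m x) 0 0 = \sum_j c j * x j 0.
Proof. by rewrite mxE; apply: eq_bigr => j _; rewrite !mxE. Qed.

Lemma lp_swap (x : 'I_nc -> R) (y : 'I_nb -> R) :
  \sum_i (\sum_j A i j * x j) * y i = \sum_j (\sum_i A i j * y i) * x j.
Proof.
under eq_bigr do rewrite mulr_suml.
rewrite exchange_big /=; apply: eq_bigr => j _; rewrite mulr_suml.
by apply: eq_bigr => i _; ring.
Qed.

Lemma lp_value_finite (x : 'I_nc -> R) (y : 'I_nb -> R) :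
  (forall i, \sum_j A i j * x j <= b i) -> (forall i, 0 <= y i) ->
  (forall j, \sum_i A i j * y i = - c j) ->
  \sum_i b i * y i + \sum_j c j * x j = 0 ->
  lp_value s = (\sum_j c j * x j)%:E.
Proof.
move=> xP y_ge0 yA gap; apply/le_anti/andP; split.
  apply: ereal_inf_lbound; exists (\col_j x j).
    by apply/lp_feasibleP => i; under eq_bigr do rewrite mxE.
  by rewrite lp_costE; under eq_bigr do rewrite mxE.
apply: le_ereal_inf_tmp => _ [z /lp_feasibleP zP <-].
rewrite lp_costE lee_fin.
have -> : \sum_j c j * x j = - \sum_i b i * y i by lra.
have -> : \sum_j c j * z j 0 = - \sum_i (\sum_j A i j * z j 0) * y i.
  rewrite (lp_swap (fun j => z j 0)) -sumrN; apply: eq_bigr => j _.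
  by rewrite yA; ring.
by rewrite lerN2; apply: ler_sum => i _; apply: ler_wpM2r.
Qed.

Lemma lp_value_infeasible (y : 'I_nb -> R) :
  (forall i, 0 <= y i) -> (forall j, \sum_i A i j * y i = 0) ->
  \sum_i b i * y i < 0 -> lp_value s = +oo%E.
Proof.
move=> y_ge0 yA by_lt0; rewrite /lp_value.
suff -> : lp_feasible s = set0 by rewrite image_set0 ereal_inf0.
apply/seteqP; split=> // x /lp_feasibleP xP /=.
move: by_lt0; rewrite ltNge => /negP; apply.
apply: (@le_trans _ _ (\sum_i (\sum_j A i j * x j 0) * y i)).
  by rewrite (lp_swap (fun j => x j 0)) big1 // => j _; rewrite yA mul0r.
by apply: ler_sum => i _; apply: ler_wpM2r.
Qed.

Lemma lp_value_unbounded (x d : 'I_nc -> R) :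
  (forall i, \sum_j A i j * x j <= b i) ->
  (forall i, \sum_j A i j * d j <= 0) -> \sum_j c j * d j < 0 ->
  lp_value s = -oo%E.
Proof.
move=> xP dP cd_lt0.
have value_le (r : R) : (lp_value s <= r%:E)%E.
  (* Far enough along the ray [d] the cost drops to [r]; the maximum with 0 keeps the point
     feasible. *)
  pose t := Num.max 0 ((r - \sum_j c j * x j) / \sum_j c j * d j).
  have lin (a : 'I_nc -> R) : \sum_j a j * (\col_j (x j + t * d j)) j 0 =
      \sum_j a j * x j + t * \sum_j a j * d j.
    rewrite mulr_sumr -big_split /=; apply: eq_bigr => j _; rewrite mxE; ring.
  apply: ge_ereal_inf; exists (\sum_j c j * x j + t * \sum_j c j * d j)%:E.
    exists (\col_j (x j + t * d j)); last by rewrite lp_costE lin.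
    apply/lp_feasibleP => i; rewrite lin -[leRHS]addr0 lerD //.
    by rewrite mulr_ge0_le0 // le_max lexx.
  rewrite lee_fin -lerBrDl -ler_ndivrMr // le_max lexx orbT //.
case E: (lp_value s) => [r||] //.
  by have := value_le (r - 1); rewrite E lee_fin leNgt gtrBl ltr01.
by have := value_le 0; rewrite E.
Qed.

Definition answer (mu : mode) (v : R) : \bar R :=
  match mu with
  | None => v%:E
  | Some true => +oo%E
  | Some false => -oo%E
  end.

(** Copies agree only after multiplication by the entries of A, but the constraint identities use
    them in no other way. So these identities turn into the hypotheses of one of the three value
    lemmas, with the slacks giving the inequalities. *)
Lemma certificate_sound mu (U : lp_label nb nc -> 'I_5 -> R) :
  (forall q, viol mu U (entry s) q = 0) ->
  (forall l k, k \in signed l -> 0 <= U l k) ->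
  (mu != None -> \sum_l objective mu l (U l) < 0) ->
  lp_value s = answer mu (\sum_l objective mu l (U l)).
Proof.
move=> viol0 signs vlt.
pose y i := U (inl (inl i)) 1; pose x j := U (inl (inr j)) 1.
pose d j := U (inl (inr j)) 2.
have data l : U l 0 = entry s l.
  by apply/eqP; rewrite -subr_eq0; apply/eqP; exact: (viol0 (data_key l)).
have y_ge0 i : 0 <= y i by apply: signs; rewrite !inE.
have row i k : row_viol mu U i k = 0 := viol0 (row_key i k).
have col j k : col_viol mu U j k = 0 := viol0 (col_key j k).
have dataE i j : A i j = U (inr (i, j)) 0 by rewrite data.
have Ey i j : A i j * U (inr (i, j)) 3 = A i j * y i.
  rewrite !dataE; apply: (@weighted_mean _ _ (fun j => U (inr (i, j)) 0)
    (fun j => U (inr (i, j)) 3) (U (inl (inl i)) 4)); apply/eqP;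
    rewrite -subr_eq0; apply/eqP.
  - exact: (row i 2).
  - exact: (row i 3).
  - exact: (row i 4).
have Ex i j : A i j * U (inr (i, j)) 1 = A i j * x j.
  rewrite !dataE; apply: (@weighted_mean _ _ (fun i => U (inr (i, j)) 0)
    (fun i => U (inr (i, j)) 1) (U (inl (inr j)) 3)); apply/eqP;
    rewrite -subr_eq0; apply/eqP.
  - exact: (col j 1).
  - exact: (col j 2).
  - exact: (col j 3).
have Ed i j : A i j * U (inr (i, j)) 2 = A i j * d j.
  rewrite !dataE; apply: (@weighted_mean _ _ (fun i => U (inr (i, j)) 0)
    (fun i => U (inr (i, j)) 2) (U (inl (inr j)) 3)); apply/eqP;
    rewrite -subr_eq0; apply/eqP.
  - exact: (col j 1).
  - exact: (col j 4).
  - exact: (col j 5).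
have Ax i : \sum_j A i j * x j <= (primal_rhs mu)%:~R * b i.
  have := row i 0; rewrite /row_viol /= data.
  under eq_bigr do rewrite -dataE Ex.
  have : 0 <= U (inl (inl i)) 2 by apply: signs; rewrite !inE.
  by move=> h1 h2; lra.
have Ad i : \sum_j A i j * d j <= 0.
  have := row i 1; rewrite /row_viol /=.
  under eq_bigr do rewrite -dataE Ed.
  have : 0 <= U (inl (inl i)) 3 by apply: signs; rewrite !inE.
  by move=> h1 h2; lra.
have Ay j : \sum_i A i j * y i = - ((dual_rhs mu)%:~R * c j).
  have := col j 0; rewrite /col_viol /= data.
  under eq_bigr do rewrite -dataE Ey.
  by move=> h; lra.
have byE : \sum_i U (inl (inl i)) 0 * U (inl (inl i)) 1 = \sum_i b i * y i.
  by apply: eq_bigr => i _; rewrite data.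
have cxE : \sum_j U (inl (inr j)) 0 * U (inl (inr j)) 1 = \sum_j c j * x j.
  by apply: eq_bigr => j _; rewrite data.
have /= := viol0 gap_key; rewrite /gap_viol byE cxE => gap.
have valE : \sum_l objective mu l (U l) = match mu with
    | None => \sum_j c j * x j
    | Some true => \sum_i b i * y i
    | Some false => \sum_j c j * d j
    end.
  have z0 (I : finType) (f : I -> R) : (forall i, f i = 0) -> \sum_i f i = 0.
    by move=> f0; apply: big1.
  rewrite !big_sumType /=.
  case: (mu) => [[]|]; rewrite /objective /=.
  - rewrite [X in _ + X + _]z0 ?[X in _ + X]z0 ?addr0; first last.
      by move=> j; rewrite big_nil.
      by move=> [i j]; rewrite big_nil.
    apply: eq_bigr => i _.
    by rewrite big_seq1 /mono !big_cons big_nil mulr1 data.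
  - rewrite [X in X + _ + _]z0 ?[X in _ + X]z0 ?addr0 ?add0r; first last.
      by move=> i; rewrite big_nil.
      by move=> [i j]; rewrite big_nil.
    apply: eq_bigr => i _.
    by rewrite big_seq1 /mono !big_cons big_nil mulr1 data.
  - rewrite [X in X + _ + _]z0 ?[X in _ + X]z0 ?addr0 ?add0r; first last.
      by move=> i; rewrite big_nil.
      by move=> [i j]; rewrite big_nil.
    apply: eq_bigr => i _.
    by rewrite big_seq1 /mono !big_cons big_nil mulr1 data.
rewrite valE in vlt *; case: mu Ax Ay gap vlt {viol0 row col valE} =>
  [[]|] /= Ax Ay gap vlt.
- apply: lp_value_infeasible (vlt isT) => // j.
  by rewrite Ay mul0r oppr0.
- apply: lp_value_unbounded Ad (vlt isT) => i.
  by rewrite -[b i]mul1r; apply: Ax.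
- apply: lp_value_finite y_ge0 _ _ => [i|j|].
  + by rewrite -[b i]mul1r; apply: Ax.
  + by rewrite Ay mul1r.
  + by rewrite -[LHS]mul1r.
Qed.

End Value.

(** * The verifier *)

(** With the other coordinates fixed, at most one value of the coordinate [e] makes the sum vanish.
    Hence adding elements of ['I_3], modulo 3, to that coordinate is injective on [Z] times
    ['I_3]. *)
Lemma card_random_zero (R : realDomainType) (T : finType) (x : T -> R) (e : T) :
  x e != 0 ->
  (#|[pred w : {ffun T -> 'I_3} | (\sum_q (w q)%:R * x q == 0)%R]| * 3 <=
   #|{ffun T -> 'I_3}|)%N.
Proof.
move=> xe; set Z := [pred w | _].
pose shift (p : {ffun T -> 'I_3} * 'I_3) : {ffun T -> 'I_3} :=
  [ffun q => if q == e then p.1 q + p.2 else p.1 q].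
have -> : (#|Z| * 3)%N = #|[predX Z & 'I_3]| by rewrite cardX card_ord.
rewrite -(@card_in_imset _ _ shift) ?max_card // => -[w k] [w' k'].
rewrite !inE /= !andbT => /eqP w0 /eqP w'0 /ffunP ww'.
have off q : q != e -> w q = w' q.
  by move=> /negPf qe; have := ww' q; rewrite !ffunE qe.
have we : w e = w' e.
  apply: val_inj; apply/eqP; rewrite -(eqr_nat R); apply/eqP.
  apply: (mulIf xe).
  rewrite (bigD1 e) //= in w0; rewrite (bigD1 e) //= in w'0.
  rewrite (eq_bigr (fun q => (w' q)%:R * x q)) in w0; last first.
    by move=> q /off ->.
  by apply: (addIr (\sum_(i | i != e) (w' i)%:R * x i)); rewrite w0 w'0.
have := ww' e; rewrite !ffunE eqxx /= we => /addrI ->.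
by congr (_, _); apply/ffunP => q; case: (eqVneq q e) => [->|/off].
Qed.

(** * The automaton and its invariant *)

Section Verifier.
Variables nb nc N : nat.
Local Notation label := (lp_label nb nc).
Local Notation key := (key nb nc).

(* An annotation word announces the mode, or stores the number next to it in a
   buffer register, or has the buffer processed as the packet of a label. *)
Definition word : finType := (mode + 'I_5 + label)%type.

Definition decode (a : 'I_N) : option word :=
  omap enum_val (insub (nat_of_ord a) : option 'I_#|word|).

Definition encode (wordN : (#|word| <= N)%N) (x : word) : 'I_N :=
  widen_ord wordN (enum_rank x).

Lemma encodeK wordN x : decode (encode wordN x) = Some x.
Proof.
rewrite /decode /encode /=; case: insubP => [r _ /val_inj ->|].
  by rewrite /= enum_rankK.
by rewrite ltn_ord.
Qed.

(* None after a rejection, Some None before the mode is known, and otherwise the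
   mode and the label of the last packet. *)
Definition ctl : finType := option (option (mode * option label)).

(** Five registers buffer a packet, [freg] accumulates the random combination of the defects and
    [oreg] the claimed value. *)
Definition reg (k : 'I_5) : 'I_(5 + 2) := lshift 2 k.
Definition freg : 'I_(5 + 2) := rshift 5 0.
Definition oreg : 'I_(5 + 2) := rshift 5 1.

(* Packets come in increasing order, so there is at most one for each label. *)
Definition after (last : option label) (l : label) : bool :=
  if last is Some l' then (enum_rank l' < enum_rank l)%N else true.

Definition mono_expr (ks : seq 'I_5) (z : int) : expr (5 + 2) :=
  foldr (fun k e => EMul (EReg (reg k)) e) (EConst z) ks.

Definition random : finType := {ffun key -> 'I_3}.

(** An item is subtracted with the coefficient of its data identity, so repeated occurrences of an
    entry add up by themselves. *)
Definition item_update (w : random) (l : label) (i : 'I_(5 + 2)) :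
    expr (5 + 2) :=
  if i == freg then
    EAdd (EReg freg) (EMul (EConst (- (w (data_key l))%:Z)) EInput)
  else EReg i.

Definition packet_update (w : random) mu (l : label) (i : 'I_(5 + 2)) :
    expr (5 + 2) :=
  if i == freg then
    foldr (fun t e =>
      EAdd (EMul (EConst (w t.1)%:Z) (mono_expr t.2.2 t.2.1)) e)
      (EReg freg) (terms mu l)
  else if i == oreg then
    foldr (fun ks e => EAdd (mono_expr ks 1) e) (EReg oreg) (value_terms mu l)
  else EReg i.

Definition vlp_step (w : random) (c : ctl) (a : label + 'I_N) :
    tree (5 + 2) (ctl * ('I_(5 + 2) -> expr (5 + 2))) :=
  let reject := Leaf _ (None, @EReg (5 + 2)) in
  match a with
  | inl l => Leaf _ (c, item_update w l)
  | inr a =>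
    match c, decode a with
    | Some None, Some (inl (inl mu)) => Leaf _ (Some (Some (mu, None)), @EReg _)
    | Some (Some _), Some (inl (inr k)) =>
        Leaf _ (c, fun i => if i == reg k then EInput else EReg i)
    | Some (Some (mu, last)), Some (inr l) =>
        if after last l then
          foldr (fun k t => IfNonneg (EReg (reg k)) t reject)
            (Leaf _ (Some (Some (mu, Some l)), packet_update w mu l)) (signed l)
        else reject
    | _, _ => reject
    end
  end.

(** Two sign tests amount to [freg] being zero; the claim of an infinite value also needs a negative
    value of the Farkas vector or of the ray. *)
Definition vlp_answer (w : random) (c : ctl) :
    tree (5 + 2) (option (\bar (expr (5 + 2)))) :=
  if c is Some (Some (mu, _)) then
    IfNonneg (EReg freg)
      (IfNonneg (EMul (EConst (-1)) (EReg freg))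
        match mu with
        | None => Leaf _ (Some (EFin (EReg oreg)))
        | Some b => IfNonneg (EReg oreg) (Leaf _ None)
            (Leaf _ (Some (if b then EPInf _ else ENInf _)))
        end (Leaf _ None)) (Leaf _ None)
  else Leaf _ None.

Lemma random_gt0 : (0 < #|random|)%N.
Proof. by rewrite card_ffun card_ord expn_gt0. Qed.

Definition vlp : verifier label N :=
  Verifier random_gt0 (Some None) vlp_step vlp_answer.

Variable R : realType.
Implicit Types (w : random) (u : 'I_5 -> R).

Definition regs u (f o : R) (i : 'I_(5 + 2)) : R :=
  match split i with
  | inl k => u k
  | inr k => if k == 0 then f else o
  end.

Definition packets := seq (label * ('I_5 -> R)).

Definition coef w (q : key) : R := (w q)%:R.

Definition fval w (xs : seq (label * R)) mu (ps : packets) : R :=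
  \sum_(p <- ps) fp (coef w) mu p.1 p.2 -
  \sum_(x <- xs) coef w (data_key x.1) * x.2.

Definition oval mu (ps : packets) : R := \sum_(p <- ps) objective mu p.1 p.2.

Lemma regs_reg u f o k : regs u f o (reg k) = u k.
Proof. by rewrite /regs (unsplitK (inl _ k)). Qed.

Lemma regs_freg u f o : regs u f o freg = f.
Proof. by rewrite /regs (unsplitK (inr _ _)). Qed.

Lemma regs_oreg u f o : regs u f o oreg = o.
Proof. by rewrite /regs (unsplitK (inr _ _)). Qed.

Lemma regs_ext (r : 'I_(5 + 2) -> R) u f o :
  (forall k, r (reg k) = u k) -> r freg = f -> r oreg = o -> r = regs u f o.
Proof.
move=> ru rf ro; apply/funext => i; rewrite -(splitK i) /regs unsplitK.
case: (split i) => k /=; first by apply: ru.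
case: ifPn => [/eqP -> //|k0]; rewrite -ro; congr (r (rshift _ _)).
by apply: val_inj; case: k k0 => -[|[|?]].
Qed.

Lemma eval_mono x u f o ks z :
  Defs.eval x (regs u f o) (mono_expr ks z) = mono u ks * z%:~R.
Proof.
elim: ks => [|k ks IHks] /=; first by rewrite /mono big_nil mul1r.
by rewrite IHks regs_reg /mono big_cons mulrA.
Qed.

Lemma update_item w l x u f o :
  (fun i => Defs.eval x (regs u f o) (item_update w l i)) =
  regs u (f - coef w (data_key l) * x) o.
Proof.
apply: regs_ext => [k||]; rewrite /item_update.
- by rewrite eq_lrshift /= regs_reg.
- by rewrite eqxx /= regs_freg rmorphN mulNr.
- by rewrite eq_rshift /= regs_oreg.
Qed.

Lemma update_store k x u f o :
  (fun i => Defs.eval x (regs u f o) (if i == reg k then EInput else EReg i)) =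
  regs (fun k' => if k' == k then x else u k') f o.
Proof.
apply: regs_ext => [k'||].
- by rewrite eq_lshift; case: ifP => //=; rewrite regs_reg.
- by rewrite eq_rlshift /= regs_freg.
- by rewrite eq_rlshift /= regs_oreg.
Qed.

Lemma update_packet w mu l x u f o :
  (fun i => Defs.eval x (regs u f o) (packet_update w mu l i)) =
  regs u (fp (coef w) mu l u + f) (objective mu l u + o).
Proof.
apply: regs_ext => [k||]; rewrite /packet_update.
- by rewrite !eq_lrshift /= regs_reg.
- rewrite eqxx /fp; elim: (terms mu l) => [|t ts IHts] /=.
    by rewrite big_nil add0r regs_freg.
  by rewrite IHts eval_mono big_cons addrA.
- rewrite eq_rshift /= /objective.
  elim: (value_terms mu l) => [|ks kss IHks] /=.
    by rewrite big_nil add0r regs_oreg.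
  by rewrite IHks eval_mono big_cons mulr1 addrA.
Qed.

Definition nonneg_packet (p : label * ('I_5 -> R)) : bool :=
  all (fun k => 0 <= p.2 k) (signed p.1).

Lemma decide_signed (L : Type) x u f o l (t t' : L) :
  decide x (regs u f o)
    (foldr (fun k t => IfNonneg (EReg (reg k)) t (Leaf _ t')) (Leaf _ t) (signed l))
  = if nonneg_packet (l, u) then t else t'.
Proof.
rewrite /nonneg_packet; elim: (signed l) => [|k ks IHks] //=.
by rewrite regs_reg IHks; case: ifP.
Qed.

Definition items (ys : seq (symbol R label N)) : seq (label * R) :=
  pmap (fun y : symbol R label N => if y.1 is inl l then Some (l, y.2) else None) ys.

Definition decreasing (ps : packets) : bool :=
  sorted (fun p q => (enum_rank q.1 < enum_rank p.1)%N) ps.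

Definition numbers (ys : seq (symbol R label N)) : seq R :=
  0 :: [seq y.2 | y <- ys].

(** The point is the order of quantifiers: control, buffer, mode and packets are fixed before the
    random string [w], which affects only [freg]. The latest packet comes first in [ps], hence the
    decreasing order. *)
Record state_spec ys (c : ctl) u mu (ps : packets) : Prop := StateSpec {
  spec_run : forall w,
    run (V := vlp) w ys = (c, regs u (fval w (items ys) mu ps) (oval mu ps));
  spec_decr : decreasing ps;
  spec_nonneg : all nonneg_packet ps;
  spec_start : c = Some None -> ps = [::];
  spec_last : forall mu' last, c = Some (Some (mu', last)) ->
    mu' = mu /\ last = ohead [seq p.1 | p <- ps];
  spec_buffer : forall k, u k \in numbers ys;
  spec_numbers : all (fun p => [forall k, p.2 k \in numbers ys]) ps
}.

Lemma runP ys : exists c u mu ps, state_spec ys c u mu ps.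
Proof.
elim/last_ind: ys => [|ys [a x] [c [u [mu [ps [Hrun Hdecr Hnn Hst Hlast Hbuf Hnum]]]]]].
  exists (Some None), (fun=> 0), None, [::]; split=> //; last first.
    by move=> k; rewrite inE eqxx.
  move=> w; rewrite /run /=; congr (_, _); apply: regs_ext => //.
  - by rewrite /fval !big_nil subr0.
  - by rewrite /oval big_nil.
have numS : {subset numbers ys <= numbers (rcons ys (a, x))}.
  by move=> z; rewrite !inE map_rcons mem_rcons inE => /orP[->|->]; rewrite ?orbT.
have numx : x \in numbers (rcons ys (a, x)).
  by rewrite inE map_rcons mem_rcons inE eqxx orbT.
have Hbuf' k : u k \in numbers (rcons ys (a, x)) := numS _ (Hbuf k).
have Hnum' : all (fun p : label * ('I_5 -> R) =>
    [forall k, p.2 k \in numbers (rcons ys (a, x))]) ps.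
  by apply: sub_all Hnum => p /forallP pP; apply/forallP => k; apply: numS.
have itemsE a' : items (rcons ys (inr a', x)) = items ys.
  by rewrite /items -cats1 pmap_cat cats0.
have runE w : run (V := vlp) w (rcons ys (a, x)) =
    step (V := vlp) w (c, regs u (fval w (items ys) mu ps) (oval mu ps)) (a, x).
  by rewrite /run foldl_rcons -/(run (V := vlp) w ys) Hrun.
case: a => [l|a] in numS numx Hbuf' Hnum' runE *.
  exists c, u, mu, ps; split=> // w; rewrite runE /step /= update_item.
  congr (_, regs _ _ _); rewrite /fval /items -cats1 pmap_cat /= big_cat big_seq1.
  by rewrite opprD addrA.
have rejectP : (forall w, run (V := vlp) w (rcons ys (inr a, x)) =
    (None, regs u (fval w (items ys) mu ps) (oval mu ps))) ->
    exists c u mu ps, state_spec (rcons ys (inr a, x)) c u mu ps.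
  by move=> rejE; exists None, u, mu, ps; split=> // w; rewrite rejE itemsE.
case: c => [[[mu' last]|]|] in Hrun Hst Hlast runE *; last 2 first.
- case decE : (decode a) => [[[mu'|k]|l]|];
    try by apply: rejectP => w; rewrite runE /step /= decE.
  (* No packet precedes the announcement, so the announced mode may replace the previous [mu]. *)
  exists (Some (Some (mu', None))), u, mu', ps; split=> //.
  + move=> w; rewrite runE /step /= decE /= itemsE Hst // /fval /oval.
    by rewrite !big_nil.
  + by move=> _ _ [<- <-]; rewrite Hst.
- by apply: rejectP => w; rewrite runE.
have [mu'E lastE] := Hlast _ _ erefl; rewrite mu'E lastE in runE *.
case decE : (decode a) => [[[mu''|k]|l]|];
  try by apply: rejectP => w; rewrite runE /step /= decE.
  exists (Some (Some (mu, ohead [seq p.1 | p <- ps]))),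
    (fun k' => if k' == k then x else u k'), mu, ps; split=> //.
  - by move=> w; rewrite runE /step /= decE /= update_store itemsE.
  - by move=> _ _ [<- <-].
  - by move=> k'; case: ifP.
case aftE : (after (ohead [seq p.1 | p <- ps]) l); last first.
  by apply: rejectP => w; rewrite runE /step /= decE aftE.
have stepE w : run (V := vlp) w (rcons ys (inr a, x)) =
    (if nonneg_packet (l, u) then (Some (Some (mu, Some l)),
       regs u (fval w (items ys) mu ((l, u) :: ps)) (oval mu ((l, u) :: ps)))
     else (None, regs u (fval w (items ys) mu ps) (oval mu ps))).
  rewrite runE /step /= decE aftE decide_signed; case: ifP => _ //.
  rewrite update_packet; congr (_, regs _ _ _).
    by rewrite /fval big_cons addrA.
  by rewrite /oval big_cons.
case nnE : (nonneg_packet (l, u)); last first.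
  by apply: rejectP => w; rewrite stepE nnE.
exists (Some (Some (mu, Some l))), u, mu, ((l, u) :: ps); split=> //.
- by move=> w; rewrite stepE nnE itemsE.
- by rewrite /decreasing /=; case: (ps) Hdecr aftE => //= p ps' -> ->.
- by rewrite /= nnE.
- by move=> _ _ [<- <-].
- by rewrite /= Hnum' andbT; apply/forallP.
Qed.

End Verifier.

(** * Soundness of the protocol *)

Section Protocol.
Variables (R : realType) (nb nc N m : nat).
Local Notation label := (lp_label nb nc).
Local Notation key := (key nb nc).
Local Notation vlp := (vlp nb nc N).
Implicit Types (ps : packets nb nc R) (s : stream R label m).

(** For distinct labels this is the packet of [l], or zero if there is none. *)
Definition packet_fun ps (l : label) (k : 'I_5) : R :=
  \sum_(p <- ps | p.1 == l) p.2 k.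

(** [G] need not be additive, so two packets of one label could not be merged; this is why the
    verifier insists on increasing order. *)
Lemma sum_packets ps (G : label -> ('I_5 -> R) -> R) :
  uniq [seq p.1 | p <- ps] -> (forall l, G l (fun=> 0) = 0) ->
  \sum_(p <- ps) G p.1 p.2 = \sum_l G l (packet_fun ps l).
Proof.
move=> + G0; elim: ps => [_|p ps IHps /= /andP[pps /IHps ups]].
  rewrite big_nil big1 // => l _; rewrite -(G0 l); congr G.
  by apply/funext => k; rewrite /packet_fun big_nil.
have off l : p.1 != l -> packet_fun (p :: ps) l = packet_fun ps l.
  by move=> /negPf pl; apply/funext => k; rewrite /packet_fun big_cons pl.
have ps0 : packet_fun ps p.1 = fun=> 0.
  apply/funext => k; rewrite /packet_fun big_seq_cond big1 // => q /andP[qps].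
  by move=> /eqP qp; move: pps; rewrite -qp map_f.
rewrite big_cons ups (bigD1 p.1) //= [in RHS](bigD1 p.1) //= ps0 G0 add0r.
congr (G _ _ + _).
  apply/funext => k; rewrite /packet_fun big_cons eqxx.
  by rewrite -/(packet_fun ps p.1 k) ps0 addr0.
by apply: eq_bigr => l lp; rewrite off // eq_sym.
Qed.

Lemma fp0 (g : key -> R) mu l : fp g mu l (fun=> 0) = 0.
Proof.
rewrite /fp; case: l => [[i|j]|[i j]] /=;
  by rewrite !big_cons big_nil /mono /= !big_cons !big_nil; ring.
Qed.

Lemma objective0 mu (l : label) : objective mu l (fun=> 0 : R) = 0.
Proof.
rewrite /objective; case: l mu => [[i|j]|[i j]] [[]|] /=;
  by rewrite ?big_cons ?big_nil // /mono !big_cons ?big_nil; ring.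
Qed.

Lemma decreasing_uniq ps : decreasing ps -> uniq [seq p.1 | p <- ps].
Proof.
move=> dps; apply: (@sorted_uniq _ (fun l l' : label =>
  enum_rank l' < enum_rank l)%N); last by rewrite sorted_map.
- by move=> x y z /= yx zy; apply: ltn_trans zy yx.
- by move=> x /=; rewrite ltnn.
Qed.

Lemma sum_entry s (g : label -> R) :
  \sum_(x <- s) g x.1 * x.2 = \sum_l g l * entry s l.
Proof.
rewrite /entry; under [in RHS]eq_bigr do rewrite mulr_sumr.
rewrite (exchange_big_dep xpredT) //=; apply: eq_bigr => x _.
by rewrite (big_pred1 x.1) // => l; rewrite eq_sym.
Qed.

Lemma fval_viol w s mu ps : decreasing ps ->
  fval w s mu ps =
  \sum_q (w q)%:R * viol mu (packet_fun ps) (entry s) q.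
Proof.
move=> /decreasing_uniq ups.
rewrite -(sum_fp (coef R w)) /fval (sum_packets ups (fp0 _ mu)).
by rewrite (sum_entry s (fun l => coef R w (data_key l))).
Qed.

Lemma items_transcript s (h : annotation R N) : items (transcript s h) = s.
Proof.
rewrite /items /transcript pmap_cat.
have -> : forall xs : seq (label * R), pmap (fun y : symbol R label N =>
    if y.1 is inl l then Some (l, y.2) else None)
    [seq (inl x.1, x.2) | x <- xs] = xs.
  by elim=> [|[l x] xs IHxs] //=; rewrite IHxs.
by elim: h => [|y h IHh] //=; rewrite cats0.
Qed.

Definition outcome mu (f o : R) : option (\bar R) :=
  if (f == 0) && ~~ ((mu != None) && (0 <= o)) then Some (answer mu o) else None.

Lemma outputE w s h mu last u f o :
  run (V := vlp) w (transcript s h) = (Some (Some (mu, last)), regs u f o) ->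
  output (V := vlp) w s h = outcome mu f o.
Proof.
move=> runE; rewrite /output runE /= regs_freg rmorphN1 mulN1r oppr_ge0.
rewrite /outcome eq_le andbC.
case: (0 <= f) => /=; case: (f <= 0); rewrite ?andbF //.
by case: mu {runE} => [[]|] /=; rewrite regs_oreg; case: (0 <= o).
Qed.

Lemma output_reject w s h c (r : 'I_(5 + 2) -> R) :
  run (V := vlp) w (transcript s h) = (c, r) ->
  (forall mu last, c <> Some (Some (mu, last))) ->
  output (V := vlp) w s h = None.
Proof.
move=> runE cP; rewrite /output runE /=.
by case: c runE cP => [[[mu last]|]|] // _ /(_ mu last).
Qed.

Lemma prob_all (E : pred (vrand vlp)) : (forall w, E w) -> prob R E = 1.
Proof.
move=> allE; rewrite /prob (eq_card (B := vrand vlp)) => [|w].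
  by rewrite divff // pnatr_eq0 -lt0n vrand_gt0.
by rewrite !inE; exact: allE.
Qed.

Lemma prob_third (E : pred (vrand vlp)) :
  (#|E| * 3 <= #|vrand vlp|)%N -> prob R E <= 1 / 3.
Proof.
move=> cardE; rewrite /prob ler_pdivrMr ?ltr0n ?vrand_gt0 //.
by rewrite mulrAC ler_pdivlMr // mul1r -natrM ler_nat.
Qed.

(** A run that ends in rejection or without a mode never answers. Otherwise a non-zero defect is
    missed by at most a third of the random strings. Without defects the combination is always zero;
    then either the sign test for an infinite value always fails, or the certificate is sound and
    the answer always correct. *)
Lemma helper_dichotomy (H : helper R label N m) s :
  valid_for vlp (@lp_value R nb nc m) H s \/ third_invalid_for vlp H s.
Proof.
have [c [u [mu [ps [Hrun dps nnps _ Hlast _ _]]]]] := runP (transcript s (H s)).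
rewrite items_transcript in Hrun.
have invalid : (forall w, output (V := vlp) w s (H s) = None) ->
    third_invalid_for vlp H s.
  move=> outN; apply: prob_third; rewrite eq_card0 // => w.
  by rewrite !inE outN.
case: (pselect (exists mu last, c = Some (Some (mu, last)))); last first.
  move=> cP; right; apply: invalid => w; apply: output_reject (Hrun w) _.
  by move=> mu' last cE; apply: cP; exists mu', last.
move=> [mu' [last cE]]; have [mu'E _] := Hlast _ _ cE.
have outE w : output (V := vlp) w s (H s) =
    outcome mu (fval w s mu ps) (oval mu ps).
  by apply: outputE; rewrite Hrun cE mu'E.
have [/existsP[q qP]|/existsPn viol0] :=
    boolP [exists q, viol mu (packet_fun ps) (entry s) q != 0].
  right; apply: prob_third; apply: leq_trans (card_random_zero qP).
  rewrite leq_mul2r; apply/orP; right; apply/subset_leq_card/fintype.subsetP => w.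
  rewrite !inE outE /outcome fval_viol //.
  by case: ifP => // /andP[].
have fval0 w : fval w s mu ps = 0.
  rewrite fval_viol // big1 // => q _.
  by have := viol0 q; rewrite negbK => /eqP ->; rewrite mulr0.
case vE : ((mu != None) && (0 <= oval mu ps)).
  by right; apply: invalid => w; rewrite outE /outcome vE andbF.
left; apply: prob_all => w /=; rewrite outE /outcome fval0 eqxx vE /=.
have ovalE : oval mu ps = \sum_l objective mu l (packet_fun ps l).
  by rewrite /oval (sum_packets (decreasing_uniq dps) (objective0 mu)).
rewrite ovalE (@certificate_sound _ _ _ _ s mu (packet_fun ps)) // => [q|l k kl|muN].
- by have := viol0 q; rewrite negbK => /eqP.
- rewrite /packet_fun big_seq_cond; apply: sumr_ge0 => p /andP[pps /eqP pl].
  by have /allP := allP nnps p pps; apply; rewrite pl.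
- by rewrite -ovalE ltNge; rewrite muN /= in vE; rewrite vE.
Qed.

End Protocol.

(** * The honest helper *)

Section Honest.
Variables (R : realType) (nb nc N m : nat).
Local Notation label := (lp_label nb nc).
Local Notation vlp := (vlp nb nc N).
Hypothesis wordN : (#|word nb nc| <= N)%N.
Implicit Types (s : stream R label m) (U : label -> 'I_5 -> R).

Definition packet_code (l : label) (u : 'I_5 -> R) : annotation R N :=
  rcons [seq (encode wordN (inl (inr k)), u k) | k <- enum 'I_5]
    (encode wordN (inr l), 0).

Definition sorted_labels (P : pred label) : seq label :=
  [seq l <- [seq enum_val i | i <- enum 'I_#|label|] | P l].

Definition certificate_code mu U (P : pred label) : annotation R N :=
  (encode wordN (inl (inl mu)), 0) ::
  flatten [seq packet_code l (U l) | l <- sorted_labels P].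

Local Notation steps w := (foldl (@step R label N vlp w)).
Local Notation notes h := [seq (inr x.1, x.2) | x <- h].

Lemma steps_items w (xs : seq (label * R)) c u f o :
  steps w (c, regs u f o) [seq (inl x.1, x.2) | x <- xs] =
  (c, regs u (f - \sum_(x <- xs) coef R w (data_key x.1) * x.2) o).
Proof.
elim: xs f => [|x xs IHxs] f /=; first by rewrite big_nil subr0.
by rewrite /step /= update_item IHxs big_cons opprD addrA.
Qed.

(** All five components are stored, so the previous buffer [u0] leaves no trace. *)
Lemma steps_packet w mu last l u0 u f o :
  after last l -> nonneg_packet (l, u) ->
  steps w (Some (Some (mu, last)), regs u0 f o) (notes (packet_code l u)) =
  (Some (Some (mu, Some l)),
   regs u (fp (coef R w) mu l u + f) (objective mu l u + o)).
Proof.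
move=> aft nn; rewrite /packet_code map_rcons foldl_rcons.
have store (ks : seq 'I_5) u1 :
    steps w (Some (Some (mu, last)), regs u1 f o)
      (notes [seq (encode wordN (inl (inr k)), u k) | k <- ks]) =
    (Some (Some (mu, last)), regs (fun k => if k \in ks then u k else u1 k) f o).
  elim: ks u1 => [|k ks IHks] u1 //=.
  rewrite {2}/step /= encodeK /= update_store IHks.
  congr (_, regs _ _ _); apply/funext => k'; rewrite inE.
  by case: (eqVneq k' k) => [->|_] //=; case: ifP.
rewrite store.
have -> : (fun k => if k \in enum 'I_5 then u k else u0 k) = u.
  by apply/funext => k; rewrite mem_enum.
by rewrite /step /= encodeK aft decide_signed nn update_packet.
Qed.

Lemma steps_packets w mu U (ls : seq label) last u f o :
  (if last is Some l then
     path (fun l l' => enum_rank l < enum_rank l')%N l ls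
   else sorted (fun l l' : label => enum_rank l < enum_rank l')%N ls) ->
  (forall l, nonneg_packet (l, U l)) ->
  exists last' u',
    steps w (Some (Some (mu, last)), regs u f o)
      (notes (flatten [seq packet_code l (U l) | l <- ls])) =
    (Some (Some (mu, last')), regs u' (\sum_(l <- ls) fp (coef R w) mu l (U l) + f)
      (\sum_(l <- ls) objective mu l (U l) + o)).
Proof.
move=> + nn; elim: ls last u f o => [|l ls IHls] last u f o lsP.
  by exists last, u; rewrite !big_nil !add0r.
have /andP[aft lsP'] : after last l &&
    path (fun l l' => enum_rank l < enum_rank l')%N l ls.
  by case: last lsP.
rewrite /= map_cat foldl_cat steps_packet //.
have [last' [u' ->]] := IHls (Some l) (U l) (fp (coef R w) mu l (U l) + f)
  (objective mu l (U l) + o) lsP'.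
exists last', u'; congr (_, regs _ _ _); rewrite big_cons; ring.
Qed.

Lemma sorted_labelsP (P : pred label) :
  sorted (fun l l' : label => enum_rank l < enum_rank l')%N (sorted_labels P).
Proof.
apply: sorted_filter; first by move=> x y z; apply: ltn_trans.
rewrite sorted_map.
rewrite (@eq_sorted _ _ (relpre val ltn)) => [|i j]; last first.
  by rewrite /= !enum_valK.
by rewrite -sorted_map val_enum_ord iota_ltn_sorted.
Qed.

Lemma sum_sorted_labels (P : pred label) (G : label -> R) :
  (forall l, ~~ P l -> G l = 0) ->
  \sum_(l <- sorted_labels P) G l = \sum_l G l.
Proof.
move=> G0; rewrite big_filter big_map big_enum_cond.
rewrite (reindex (@enum_val label label)) /=; last first.
  by apply: onW_bij; apply: enum_val_bij.
rewrite [RHS](bigID (fun i => P (enum_val i))) /= [X in _ + X]big1 ?addr0 //.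
by move=> i; apply: G0.
Qed.

(** Labels outside [P] contribute zero, so both accumulators end up as if all packets had been sent,
    and by [sum_fp] the combination is zero for every random string. *)
Lemma certificate_output s mu U (P : pred label) :
  (forall q, viol mu U (entry s) q = 0) ->
  (forall l, nonneg_packet (l, U l)) ->
  (mu != None -> \sum_l objective mu l (U l) < 0) ->
  (forall l g, ~~ P l -> fp g mu l (U l) = 0) ->
  (forall l, ~~ P l -> objective mu l (U l) = 0) ->
  forall w, output (V := vlp) w s (certificate_code mu U P) = Some (lp_value s).
Proof.
move=> viol0 nn vlt fpP objP w.
have [last [u runE]] := @steps_packets w mu U (sorted_labels P) None (fun=> 0)
  (0 - \sum_(x <- s) coef R w (data_key x.1) * x.2) 0 (sorted_labelsP P) nn.
rewrite (@outputE _ _ _ _ _ w s _ mu last u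
    (\sum_l fp (coef R w) mu l (U l) -
      \sum_(x <- s) coef R w (data_key x.1) * x.2)
    (\sum_l objective mu l (U l))).
  have -> : \sum_(x <- s) coef R w (data_key x.1) * x.2 =
      \sum_l coef R w (data_key l) * entry s l.
    exact: (sum_entry s (fun l => coef R w (data_key l))).
  rewrite sum_fp big1 => [|q _]; last by rewrite viol0 mulr0.
  rewrite /outcome eqxx (certificate_sound viol0) //=.
    by case muN : (mu != None) => //=; rewrite leNgt vlt.
  by move=> l k kl; apply: (allP (nn l)).
rewrite /run /transcript foldl_cat.
have -> : initial R vlp = (Some None, regs (fun=> 0) 0 0).
  by congr (_, _); apply: regs_ext.
rewrite steps_items /= {2}/step /= encodeK /= runE addr0.
rewrite (sum_sorted_labels objP).
by rewrite (sum_sorted_labels (fun l => fpP l (coef R w))) sub0r.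
Qed.

End Honest.

(** * Existence and size of certificates *)

Section Certificate.
Variables (R : realType) (nb nc m : nat) (s : stream R (lp_label nb nc) m).
Local Notation label := (lp_label nb nc).

Local Notation A i j := (entry s (inr (i, j))).
Local Notation b i := (entry s (inl (inl i))).
Local Notation c j := (entry s (inl (inr j))).

Definition certificate mu (x d : 'I_nc -> R) (y : 'I_nb -> R) (l : label)
    (k : 'I_5) : R :=
  match l with
  | inl (inl i) =>
    [:: b i; y i; (primal_rhs mu)%:~R * b i - \sum_j A i j * x j;
        - \sum_j A i j * d j; \sum_j A i j ^+ 2]`_k
  | inl (inr j) => [:: c j; x j; d j; \sum_i A i j ^+ 2]`_k
  | inr (i, j) => [:: A i j; x j; d j; y i]`_k
  end.

Definition active (l : label) : bool :=
  match l with
  | inl (inl i) => (b i != 0) || [exists j, A i j != 0]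
  | inl (inr j) => (c j != 0) || [exists i, A i j != 0]
  | inr _ => entry s l != 0
  end.

(** Slacks defined as residuals, exact sums of squares and equal copies fulfil all identities but
    the dual equation and the gap. *)
Lemma viol_certificate mu x d y :
  (forall j, \sum_i A i j * y i = - ((dual_rhs mu)%:~R * c j)) ->
  (dual_rhs mu)%:~R * (\sum_i b i * y i + \sum_j c j * x j) = 0 ->
  forall q, viol mu (certificate mu x d y) (entry s) q = 0.
Proof.
move=> Ay gap [[[l|[i k]]|[j k]]|o] /=; last by [].
- by rewrite (_ : certificate _ _ _ _ _ _ = entry s l) ?subrr //;
    case: l => [[i|j]|[i j]].
- rewrite /row_viol; case: k => -[|[|[|[|[|]]]]] //= _; rewrite /certificate /=.
  + ring.
  + by rewrite addNr.
  + by rewrite subrr.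
  + by rewrite mulr_suml subrr.
  + by rewrite mulr_suml subrr.
- rewrite /col_viol; case: k => -[|[|[|[|[|[|]]]]]] //= _; rewrite /certificate /=.
  + by rewrite Ay subrr.
  + by rewrite subrr.
  + by rewrite mulr_suml subrr.
  + by rewrite mulr_suml subrr.
  + by rewrite mulr_suml subrr.
  + by rewrite mulr_suml subrr.
Qed.

(** Components such as y_i or x_j need not vanish, but each term of an inactive label contains a
    factor that does: the entry itself, a slack or a sum of squares. *)
Lemma inactive_certificate mu x d y l : ~~ active l ->
  (forall g, fp g mu l (certificate mu x d y l) = 0) /\
  objective mu l (certificate mu x d y l) = 0.
Proof.
have z0 (I : finType) (f h : I -> R) :
    ~~ [exists i, f i != 0] -> \sum_i f i * h i = 0.
  move=> /existsPn f0; apply: big1 => i _.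
  by have := f0 i; rewrite negbK => /eqP ->; rewrite mul0r.
have sq0 (I : finType) (f : I -> R) :
    ~~ [exists i, f i != 0] -> \sum_i f i ^+ 2 = 0.
  by move=> f0; rewrite -[RHS](z0 _ f f f0); apply: eq_bigr => i _; rewrite expr2.
set C := certificate _ _ _ _.
case: l => [[i|j]|[i j]] /=; rewrite ?negb_or.
- case/andP => /negPn/eqP b0 A0.
  have C0 : C (inl (inl i)) 0 = 0 by rewrite /C /certificate /= b0.
  have C2 : C (inl (inl i)) 2 = 0.
    by rewrite /C /certificate /= b0 mulr0 z0 ?subrr.
  have C3 : C (inl (inl i)) 3 = 0 by rewrite /C /certificate /= z0 ?oppr0.
  have C4 : C (inl (inl i)) 4 = 0 by rewrite /C /certificate /= sq0.
  clearbody C; split=> [g|]; last first.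
    by rewrite /objective; case: (mu) => [[]|] /=;
      rewrite ?big_cons ?big_nil // /mono !big_cons big_nil C0; ring.
  rewrite /fp /= !big_cons big_nil /mono /= !big_cons !big_nil C0 C2 C3 C4; ring.
- case/andP => /negPn/eqP c0 A0.
  have C0 : C (inl (inr j)) 0 = 0 by rewrite /C /certificate /= c0.
  have C3 : C (inl (inr j)) 3 = 0 by rewrite /C /certificate /= sq0.
  clearbody C; split=> [g|]; last first.
    by rewrite /objective; case: (mu) => [[]|] /=;
      rewrite ?big_cons ?big_nil // /mono !big_cons big_nil C0; ring.
  rewrite /fp /= !big_cons big_nil /mono /= !big_cons !big_nil C0 C3; ring.
- move=> /negPn/eqP A0.
  have C0 : C (inr (i, j)) 0 = 0 by rewrite /C /certificate /= A0.
  clearbody C; split=> [g|]; last first.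
    by rewrite /objective; case: (mu) => [[]|] /=; rewrite big_nil.
  rewrite /fp /= !big_cons big_nil /mono /= !big_cons !big_nil C0; ring.
Qed.

Lemma nonneg_certificate mu x d y :
  (forall i, \sum_j A i j * x j <= (primal_rhs mu)%:~R * b i) ->
  (forall i, \sum_j A i j * d j <= 0) -> (forall i, 0 <= y i) ->
  forall l, nonneg_packet (l, certificate mu x d y l).
Proof.
move=> xP dP y_ge0 [[i|j]|[i j]] //; rewrite /nonneg_packet /= /certificate /=.
by rewrite y_ge0 subr_ge0 xP oppr_ge0 dP.
Qed.

Lemma certificate_exists : exists mu x d y, let C := certificate mu x d y in
  [/\ forall q, viol mu C (entry s) q = 0, forall l, nonneg_packet (l, C l)
    & mu != None -> \sum_l objective mu l (C l) < 0].
Proof.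
have [[x [y [xP y0 Ay gap]]]|[y [y0 Ay by0]]|[x [d [xP dP cd]]]] :=
  lp_trichotomy (fun i j => A i j) (fun i => b i) (fun j => c j).
- exists None, x, (fun=> 0), y; split=> //.
    apply: viol_certificate => [j|]; first by rewrite mul1r.
    by rewrite mul1r.
  apply: nonneg_certificate => // i; first by rewrite mul1r.
  by rewrite big1 // => j _; rewrite mulr0.
- exists (Some true), (fun=> 0), (fun=> 0), y; split=> [||_].
  + apply: viol_certificate => [j|]; first by rewrite Ay mul0r oppr0.
    by rewrite mul0r.
  + by apply: nonneg_certificate => // i; rewrite ?mul0r;
      rewrite big1 // => j _; rewrite mulr0.
  + rewrite !big_sumType /= /objective /=.
    rewrite [X in _ + X + _]big1 ?[X in _ + X]big1 ?addr0;
      try by move=> *; rewrite big_nil.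
    by under eq_bigr do rewrite big_seq1 /mono !big_cons big_nil mulr1.
- exists (Some false), x, d, (fun=> 0); split=> [||_].
  + apply: viol_certificate => [j|]; last by rewrite mul0r.
    by rewrite mul0r oppr0 big1 // => i _; rewrite mulr0.
  + by apply: nonneg_certificate => // i; rewrite mul1r.
  + rewrite !big_sumType /= /objective /=.
    rewrite [X in X + _ + _]big1 ?[X in _ + X]big1 ?addr0 ?add0r;
      try by move=> *; rewrite ?big_nil //; case: i; rewrite big_nil.
    by under eq_bigr do rewrite big_seq1 /mono !big_cons big_nil mulr1.
Qed.

(** Every active row or column meets the support of A, so the active labels lie in three images of
    the support: its rows, its columns and its entries. *)
Lemma card_active : lp_covered s -> (#|active| <= 3 * lp_nnz s)%N.
Proof.
move=> [cov_b cov_c]; rewrite /lp_nnz; set S := finset _.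
have SP i j : ((i, j) \in S) = (A i j != 0) by rewrite inE mxE.
pose row_of (p : 'I_nb * 'I_nc) : label := inl (inl p.1).
pose col_of (p : 'I_nb * 'I_nc) : label := inl (inr p.2).
pose ent_of (p : 'I_nb * 'I_nc) : label := inr p.
apply: (@leq_trans #|(row_of @: S) :|: (col_of @: S) :|: (ent_of @: S)|).
  apply/subset_leq_card/fintype.subsetP => l lact; rewrite !inE.
  suff : [\/ l \in row_of @: S, l \in col_of @: S | l \in ent_of @: S].
    by case=> ->; rewrite ?orbT.
  move: l lact => [[i|j]|[i j]]; rewrite unfold_in /=.
  - move=> h; apply: Or31.
    have [j] : exists j, A i j != 0.
      case/orP: h => [b0|/existsP//].
      have [|j] := cov_b i; first by rewrite mxE.
      by rewrite mxE; exists j.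
    by rewrite -SP => ij; apply/imsetP; exists (i, j).
  - move=> h; apply: Or32.
    have [i] : exists i, A i j != 0.
      case/orP: h => [c0|/existsP//].
      have [|i] := cov_c j; first by rewrite mxE.
      by rewrite mxE; exists i.
    by rewrite -SP => ij; apply/imsetP; exists (i, j).
  - by rewrite -SP => ij; apply: Or33; apply/imsetP; exists (i, j).
apply: leq_trans (leq_card_setU _ _) _.
apply: leq_trans (leq_add (leq_card_setU _ _) (leqnn _)) _.
by rewrite !mulSn mul0n addn0 addnA !leq_add // leq_imset_card.
Qed.

End Certificate.

(** * Costs *)

Section Precision.
Variables (R : realType) (B D : nat).
(* All contributions have degree at most 4 in the numbers read. *)
Definition quartic (c : nat) (x : R) : Prop :=
  exists2 z : int, (`|z| <= c)%N & x = z%:~R / (D ^ 4)%:R.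

Lemma quartic_le c c' x : (c <= c')%N -> quartic c x -> quartic c' x.
Proof. by move=> cc' [z zc xE]; exists z => //; apply: leq_trans cc'. Qed.

Lemma quarticD c c' x y : quartic c x -> quartic c' y -> quartic (c + c') (x + y).
Proof.
move=> [z zc ->] [z' zc' ->]; exists (z + z'); last by rewrite intrD mulrDl.
lia.
Qed.

Lemma quarticZ (k : int) c x : quartic c x -> quartic (`|k| * c) (k%:~R * x).
Proof.
move=> [z zc ->]; exists (k * z); last by rewrite intrM mulrA.
by rewrite abszM leq_mul2l zc orbT.
Qed.

Lemma quartic_sum (I : eqType) (xs : seq I) (f : I -> R) c :
  (forall x, x \in xs -> quartic c (f x)) ->
  quartic (size xs * c) (\sum_(x <- xs) f x).
Proof.
elim: xs => [|x xs IHxs] fP; rewrite ?big_nil ?big_cons.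
  by exists 0 => //; rewrite mul0r.
rewrite mulSn; apply: quarticD; first by apply: fP; rewrite inE eqxx.
by apply: IHxs => y yxs; apply: fP; rewrite inE yxs orbT.
Qed.

Hypotheses (D_gt0 : (0 < D)%N) (D_leB : (D <= B)%N).

Lemma representable0 : representable B D (0 : R).
Proof. by split; [apply/andP | exists 0 => //; rewrite mul0r]. Qed.

(** A product of fewer than four fractions over D is brought to the denominator D^4 by padding with
    powers of D, which are at most those of B. *)
Lemma quartic_mono (u : 'I_5 -> R) ks : (forall k, representable B D (u k)) ->
  (size ks <= 4)%N -> quartic (B ^ 4) (mono u ks).
Proof.
move=> uP ks4.
have DR n : (D ^ n)%:R != 0 :> R by rewrite pnatr_eq0 -lt0n expn_gt0 D_gt0.
have [z zB ->] : exists2 z : int, (`|z| <= B ^ size ks)%N &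
    mono u ks = z%:~R / (D ^ size ks)%:R.
  elim: ks {ks4} => [|k ks [z zB IHks]]; rewrite /mono.
    by exists 1; rewrite ?big_nil ?expn0 ?divr1.
  have [_ [z' z'B ukE]] := uP k; exists (z' * z).
    by rewrite abszM expnS leq_mul.
  by rewrite big_cons -/(mono u ks) IHks ukE expnS natrM rmorphM /= invfM mulrACA.
exists (z * (D ^ (4 - size ks))%:Z).
  have -> : (B ^ 4 = B ^ size ks * B ^ (4 - size ks))%N.
    by rewrite -expnD subnKC.
  rewrite abszM absz_nat leq_mul //.
  by case: (4 - size ks)%N => // e; rewrite leq_exp2r.
rewrite rmorphM /= -pmulrn.
have -> : (D ^ 4 = D ^ size ks * D ^ (4 - size ks))%N.
  by rewrite -expnD subnKC.
by rewrite natrM invfM mulrACA divff // mulr1.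
Qed.

Lemma quartic_representable n x : (3 < n)%N -> quartic (B ^ n) x ->
  representable (B ^ n) (D ^ 4) x.
Proof.
move=> n4 [z zB xE]; split; last by exists z.
rewrite expn_gt0 D_gt0 /=; apply: (@leq_trans (B ^ 4)); first by rewrite leq_exp2r.
by rewrite leq_pexp2l // (leq_trans D_gt0).
Qed.

End Precision.

(** The constant 24 stands for at most twelve terms, each with a random coefficient of at most 2. *)
Lemma quartic_fp (R : realType) (B D nb nc : nat) (w : random nb nc) mu l
    (u : 'I_5 -> R) : (0 < D)%N -> (D <= B)%N ->
  (forall k, representable B D (u k)) ->
  quartic D (24 * B ^ 4) (fp (coef R w) mu l u).
Proof.
move=> D_gt0 D_leB uP.
have terms_small : all (fun t : key nb nc * (int * seq 'I_5) =>
    (size t.2.2 <= 4)%N && (`|t.2.1| <= 1)%N) (terms mu l).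
  by case: l mu => [[i|j]|[i j]] [[]|].
have size_terms : (size (terms mu l) <= 12)%N by case: l {terms_small} => [[i|j]|[i j]].
apply: (@quartic_le _ _ (size (terms mu l) * (2 * B ^ 4))).
  by rewrite mulnA leq_mul2r (@leq_mul _ 2 12 2) // orbT.
apply: quartic_sum => t /(allP terms_small) /andP[t4 t1].
have -> : coef R w t.1 * (mono u t.2.2 * t.2.1%:~R) =
  (t.2.1 * (w t.1)%:Z)%:~R * mono u t.2.2.
  by rewrite intrM /coef -pmulrn; ring.
apply: quartic_le (quarticZ _ (quartic_mono D_gt0 D_leB uP t4)).
rewrite leq_mul2r abszM absz_nat; apply/orP; right.
apply: (@leq_mul _ _ 1 2 t1).
by rewrite -ltnS ltn_ord.
Qed.

Lemma quartic_objective (R : realType) (B D nb nc : nat) mu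
    (l : lp_label nb nc) (u : 'I_5 -> R) : (0 < D)%N -> (D <= B)%N ->
  (forall k, representable B D (u k)) -> quartic D (B ^ 4) (objective mu l u).
Proof.
move=> D_gt0 D_leB uP; rewrite /objective.
have small : all (fun ks : seq 'I_5 => size ks <= 4)%N (value_terms mu l).
  by case: l mu => [[i|j]|[i j]] [[]|].
apply: (@quartic_le _ _ (size (value_terms mu l) * B ^ 4)).
  by case: l mu {small} => [[i|j]|[i j]] [[]|] //=; rewrite mul1n.
by apply: quartic_sum => ks /(allP small); apply: quartic_mono.
Qed.

Lemma card_label (nb nc M : nat) : (nb <= M)%N -> (nc <= M)%N ->
  (#|lp_label nb nc| <= M + M + M * M)%N.
Proof.
by move=> nbM ncM; rewrite !card_sum card_prod !card_ord !leq_add ?leq_mul.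
Qed.

(** The buffer holds zeros or numbers read. The accumulators are sums over at most one packet per
    label and at most m items, all over the denominator D^4, so only the numerators grow. *)
Lemma vlp_registers_fit (R : realType) (nb nc N m a : nat) :
  (nb <= m.+2 ^ a)%N -> (nc <= m.+2 ^ a)%N ->
  registers_fit R m (vlp nb nc N) (2 * a + 12).
Proof.
move=> nbM ncM B D0 s h mB small0 w t i.
(* If nothing is read then D0 is arbitrary, possibly 0. *)
have [D [D_gt0 D_leB small]] : exists D, [/\ (0 < D)%N, (D <= B)%N &
    forall y, y \in transcript s h -> representable B D y.2].
  case: (transcript s h) small0 => [|y ys] small0.
    by exists 1%N; split=> //; apply: leq_trans mB.
  have [|/andP[D_gt0 D_leB] _] := small0 y; first by rewrite inE eqxx.
  by exists D0.
have B2 : (1 < B)%N by apply: leq_trans mB.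
have [c [u [mu [ps [Hrun dps _ _ _ Hbuf Hnum]]]]] := runP (take t (transcript s h)).
rewrite {}Hrun /=; set ys := take t _ in Hbuf Hnum *.
have numP x : x \in numbers ys -> representable B D x.
  rewrite inE => /orP[/eqP ->|/mapP[y yys ->]]; first exact: representable0.
  by apply: small; apply: mem_take yys.
have uP k : representable B D (u k) by apply: numP.
have size_ps : (size ps <= #|lp_label nb nc|)%N.
  rewrite -(size_map (fun p => p.1)).
  apply: leq_trans (max_card (mem [seq p.1 | p <- ps])).
  by rewrite (card_uniqP _) // decreasing_uniq.
have size_xs : (size (items ys) <= m)%N.
  apply: (@leq_trans (size (items (transcript s h)))); last first.
    by rewrite items_transcript size_tuple.
  rewrite /items !size_pmap.
  by rewrite -[in leqRHS](cat_take_drop t (transcript s h)) count_cat leq_addr.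
have quartic_regs f : quartic D (B ^ (2 * a + 12)) f ->
    exists D', representable (B ^ (2 * a + 12)) D' f.
  by move=> fP; exists (D ^ 4)%N; apply: quartic_representable => //; rewrite ltn_addl.
have card_ps : (size ps <= 3 * B ^ (2 * a))%N.
  apply: leq_trans size_ps _; apply: leq_trans (card_label nbM ncM) _.
  have M_le : (m.+2 ^ a <= B ^ a)%N by case: (a) => // e; rewrite leq_exp2r.
  have : (0 < B ^ a)%N by rewrite expn_gt0 ltnW.
  rewrite mul2n -addnn expnD; move: M_le; move: (_ ^ _)%N (B ^ a)%N => p q; nia.
have two_le e : (2 ^ e <= B ^ e)%N by case: e => // e; rewrite leq_exp2r.
(* For the packets 72 is 3 times 24, and 2 bounds the random coefficient of an item; the factor B^8
   beyond B^(2a) and B^4 absorbs both contributions. *)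
have total c1 c2 : (c1 <= 72)%N -> (c2 <= 2)%N ->
    (c1 * B ^ (2 * a) * B ^ 4 + c2 * m * B ^ 4 <= B ^ (2 * a + 12))%N.
  move=> c1P c2P; rewrite -mulnDl.
  have -> : (2 * a + 12 = (2 * a + 8) + 4)%N by rewrite -addnA.
  rewrite [in leqRHS]expnD leq_mul2r; apply/orP; right.
  have B8 : (256 <= B ^ 8)%N := two_le 8%N.
  have B1 : (0 < B ^ (2 * a))%N by rewrite expn_gt0 ltnW.
  have B2m : (2 * m <= B ^ 2)%N by rewrite expnS expn1; nia.
  have B26 : (B ^ 2 * 64 <= B ^ 8)%N.
    by rewrite (_ : 8 = 2 + 6)%N // expnD leq_mul2l (two_le 6%N) orbT.
  rewrite expnD; move: (B ^ (2 * a))%N (B ^ 8)%N (B ^ 2)%N B8 B1 B2m B26.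
  move=> p q r; nia.
rewrite -(splitK i) /regs; case: (split i) => k /=.
  rewrite (unsplitK (inl _ k)); exists D; split.
    rewrite D_gt0; apply: leq_trans D_leB _.
    by rewrite -{1}(expn1 B) leq_exp2l // addnS ltnS.
  have [_ [z zB ukE]] := uP k; exists z => //; apply: leq_trans zB _.
  by rewrite -{1}(expn1 B) leq_exp2l // addnS ltnS.
rewrite (unsplitK (inr _ k)); case: ifP => _; apply: quartic_regs.
  rewrite /fval -mulN1r.
  apply: quartic_le (total 72 2 (leqnn _) (leqnn _)) _.
  apply: quarticD.
    apply: quartic_le (quartic_sum (c := 24 * B ^ 4) _) => [|p pps].
      rewrite mulnA leq_mul2r; apply/orP; right.
      apply: leq_trans (leq_mul card_ps (leqnn 24)) _.
      by move: (B ^ (2 * a))%N => q; lia.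
    apply: quartic_fp => // k'; apply: numP.
    by have /forallP := allP Hnum p pps; apply.
  rewrite -[-1]/((-1)%:~R); rewrite -[X in quartic _ X _]mul1n.
  apply: (quarticZ (-1)); apply: quartic_le (quartic_sum (c := 2 * B ^ 4) _).
    by rewrite mulnA [(2 * m)%N]mulnC leq_mul2r leq_mul2r size_xs !orbT.
  move=> x; rewrite mem_pmap => /mapP[[[l|a'] z] yys] // [->] /=.
  have zP : representable B D z by apply: numP; rewrite inE (map_f snd yys) orbT.
  have -> : coef R w (data_key l) * z =
      (w (data_key l))%:Z%:~R * mono (fun=> z) [:: 0].
    by rewrite /mono big_seq1 -pmulrn.
  apply: quartic_le (quarticZ _ (quartic_mono D_gt0 D_leB _ _)) => //.
  by rewrite leq_mul2r absz_nat -ltnS ltn_ord orbT.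
apply: quartic_le (total 3 0 isT isT) _; rewrite mul0n addn0.
apply: quartic_le (quartic_sum (c := B ^ 4) _) => [|p pps].
  by rewrite leq_mul2r card_ps orbT.
apply: quartic_objective => // k'; apply: numP.
by have /forallP := allP Hnum p pps; apply.
Qed.

(** * Length of the annotation and size of the memory *)

(** Five stores and a label for each packet, and one word for the mode. *)
Lemma size_certificate_code (R : realType) (nb nc N : nat)
    (wordN : (#|word nb nc| <= N)%N) mu (U : lp_label nb nc -> 'I_5 -> R) P :
  size (certificate_code wordN mu U P) = (6 * #|P|).+1.
Proof.
have size_packets ls : size (flatten [seq packet_code wordN l (U l) | l <- ls]) =
    (6 * size ls)%N.
  elim: ls => //= l ls IHls.
  by rewrite size_cat IHls size_rcons size_map size_enum_ord mulnS.
rewrite /certificate_code /= size_packets; congr (_ * _).+1.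
have <- : #|sorted_labels P| = size (sorted_labels P).
  by apply/card_uniqP; rewrite filter_uniq // map_inj_uniq ?enum_uniq //;
    apply: enum_val_inj.
apply: eq_card => l; rewrite mem_filter andb_idr // => _.
by apply/mapP; exists (enum_rank l); rewrite ?mem_enum ?enum_rankK.
Qed.

Lemma honest_annotation (R : realType) (nb nc N m : nat)
    (wordN : (#|word nb nc| <= N)%N) (s : stream R (lp_label nb nc) m) :
  exists h : annotation R N,
    (forall w, output (V := vlp nb nc N) w s h = Some (lp_value s)) /\
    (lp_covered s -> (size h <= 18 * lp_nnz s + 1)%N).
Proof.
have [mu [x [d [y [viol0 nn vlt]]]]] := certificate_exists s.
exists (certificate_code wordN mu (certificate s mu x d y) (active s)); split.
  apply: certificate_output => // l => [g|] lP;
    by have [fpE objE] := inactive_certificate mu x d y lP.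
(* Six words for each of at most three active labels per non-zero entry give 18. *)
move=> /card_active cardP; rewrite size_certificate_code addn1 ltnS.
by apply: leq_trans (leq_mul (leqnn 6) cardP) _; rewrite mulnA.
Qed.

(** Both cardinalities are linear in the number of labels with small constants, which the factor
    (m+2)^12 >= 2^12 absorbs. *)
Lemma card_word_ctl (nb nc m a : nat) :
  (nb <= m.+2 ^ a)%N -> (nc <= m.+2 ^ a)%N ->
  (#|word nb nc| <= m.+2 ^ (2 * a + 12))%N /\
  (#|ctl nb nc| <= m.+2 ^ (2 * a + 12))%N.
Proof.
move=> nbM ncM; have := card_label nbM ncM.
rewrite /word /ctl /mode !(card_option, card_sum, card_prod, card_bool, card_ord).
rewrite expnD mul2n -addnn expnD.
have : (0 < m.+2 ^ a)%N by rewrite expn_gt0.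
have : (2 ^ 12 <= m.+2 ^ 12)%N by rewrite leq_exp2r.
rewrite -[(2 ^ 12)%N]/4096%N; move: (m.+2 ^ a)%N (m.+2 ^ 12)%N => p q qP p1 L.
by move: qP p1 L; nia.
Qed.

Theorem theorem3 (R : realType) (a : nat) :
  exists k K : nat, (0 < k)%N /\
  forall m nb nc : nat, (nb <= m.+2 ^ a)%N -> (nc <= m.+2 ^ a)%N ->
  exists V : verifier (lp_label nb nc) (m.+2 ^ k),
    [/\ valid_protocol V (@lp_value R nb nc m),
        exists2 H : helper R (lp_label nb nc) (m.+2 ^ k) m,
          (forall s, valid_for V (@lp_value R nb nc m) H s) &
          (forall s, lp_covered s -> (size (H s) <= K * (lp_nnz s + 1))%N)
      & verification_cost_le R m V k (K * (1 + 1))].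
Proof.
(* The exponent is that of [card_word_ctl] and [vlp_registers_fit]; 18 comes from the length of the
   annotation, and twice 18 exceeds the 8 words of memory. *)
exists (2 * a + 12)%N, 18%N; split; first by rewrite addnS.
move=> m nb nc nbM ncM; have [wordN ctlN] := card_word_ctl nbM ncM.
exists (vlp nb nc _).
have /choice [H HP] := @honest_annotation R nb nc _ m wordN.
have H_valid s : valid_for (vlp nb nc _) (@lp_value R nb nc m) H s.
  by apply: prob_all => w /=; rewrite (HP s).1.
split.
- by split; [exists H | exact: helper_dichotomy].
- exists H => // s /(HP s).2 /leq_trans; apply.
  by rewrite mulnDr leq_add2l.
- split; last exact: vlp_registers_fit.
  (* One discrete word for the control state and seven registers. *)
  apply: (@leq_trans (1 + 7)) => //; rewrite leq_add2r.
  by apply: up_log_min; rewrite ?expn1 // -(expn0 m.+2) ltn_exp2l // addnS.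
Qed.
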